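(* Let the relevance vectors chosen by the adversary have $n+1$ grades, i.e. $R_t\in\{0,1,\dots,n\}^m$. The expected regret of DCG, obtained by applying the block algorithm with the Follow The Perturbed Leader (FTPL) full information algorithm described in the context, with feedback on the top $k$ ranked items at the end of each round ($k\ge1$), and with $K=O\Big(\frac{m^{1/3}T^{2/3}}{\lceil m/k\rceil^{2/3}}\Big)$ and $\epsilon=O\Big(\frac{1}{(2^n-1)^2\sqrt{mK}}\Big)$, satisfies $$\max_\sigma\sum_{t=1}^T\mathrm{DCG}(\sigma,R_t)-\mathbb{E}\Big[\sum_{t=1}^T\mathrm{DCG}(\sigma_t,R_t)\Big]\ \le\ O\big((2^n-1)\,m^{4/3}\lceil m/k\rceil^{1/3}T^{2/3}\big).$$
   Context: There are $m$ fixed items. A permutation $\sigma$ of the items $1,\dots,m$ maps ranks to items, and $\sigma^{-1}$ maps items to ranks; $\mathrm{DCG}(\sigma,R)=\sum_{i=1}^m\frac{2^{R(i)}-1}{\log_2(1+\sigma^{-1}(i))}$ (a gain). Online game with an oblivious adversary over $T$ rounds: at round $t$ the learner outputs a permutation $\sigma_t$, the adversary generates $R_t$, the learner gains $\mathrm{DCG}(\sigma_t,R_t)$ and observes only $R_t(\sigma_t(1)),\dots,R_t(\sigma_t(k))$ (top $k$ feedback). The expectation is over the learner's randomization, and $O(\cdot)$ hides numeric constants. Algorithm (RTop-kF with FTPL, variant for DCG), with parameters $K$ (number of blocks) and $\epsilon>0$. Divide $\{1,\dots,T\}$ into $K$ equal sized consecutive blocks $B_1,\dots,B_K$. Set $\hat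 s_0=\mathbf{0}\in\mathbb{R}^m$. For $i=1,\dots,K$: select $\lceil m/k\rceil$ time points $i_1,\dots,i_{\lceil m/k\rceil}$ from $B_i$ uniformly at random without replacement, and divide the items into $\lceil m/k\rceil$ cells of $k$ distinct items each (the last may have fewer). For $t\in B_i$: if $t=i_j$ (exploration round), output any permutation placing the items of the $j$th cell in the top positions and observe their relevances; otherwise (exploitation round) sample $p_t\in[0,1/\epsilon]^m$ from the product of uniform distributions in each dimension and output $\sigma_t=M(\hat s_{i-1}+p_t)$, where $M(y)=\arg\min_\sigma\sigma^{-1}\cdot y$. At the end of block $i$ let $\hat R_i\in\mathbb{R}^m$ be the vector whose entries are the transformed values $2^r-1$ of the $m$ relevances $r$ collected in the exploration rounds of the block, and set $\hat s_i=\hat s_{i-1}+\hat R_i$.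
   Formalization: With all O-constants numeric the claim fails (m=k=2, R_t=(n,0): regret of order (2^n-1)^2 T^(2/3)); proved instead: numeric regret constant with the constant in epsilon depending on n, and the stated epsilon with the regret constant depending on n. K, epsilon are of exact order. *)

(* Defs.v *)
From HB Require Import structures.
From mathcomp Require Import all_boot all_order all_algebra all_fingroup.
From mathcomp Require Import all_classical all_reals all_analysis.

Set Implicit Arguments.
Unset Strict Implicit.
Unset Printing Implicit Defensive.

Import Order.TTheory GRing.Theory Num.Theory.
Local Open Scope classical_set_scope.
Local Open Scope ring_scope.

(* Items, rounds, blocks and cells are numbered from 0.  A permutation
   [s : 'S_m] maps ranks (from 0) to items; [item_rank] counts from 1. *)
Definition item_rank {m : nat} (s : 'S_m) (x : 'I_m) : nat := ((s^-1)%g x).+1.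

Definition log2 {R : realType} (x : R) : R := ln x / ln 2.

Definition gain {R : realType} (r : nat) : R := 2 ^+ r - 1.

Definition dcg {R : realType} {m : nat} (s : 'S_m) (r : 'I_m -> nat) : R :=
  \sum_(x < m) gain (r x) / log2 (1 + (item_rank s x)%:R).

(* M(y) = argmin_s s^-1 . y; ties are broken by the choice operator. *)
Definition sort_perm {R : realType} {m : nat} (y : 'I_m -> R) : 'S_m :=
  [arg min_(s < (1%g : 'S_m)) (\sum_(x < m) (item_rank s x)%:R * y x)%R]%O.

Definition feedback {m : nat} (k : nat) (s : 'S_m) (r : 'I_m -> nat) : seq nat :=
  take k [seq r (s j) | j <- enum 'I_m].

(* The ceiling of m / k, for k > 0. *)
Definition ncells (m k : nat) : nat := ((m + k.-1) %/ k)%N.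

Definition block (T K : nat) (i : 'I_K) : {set 'I_T} :=
  [set t : 'I_T | (t %/ (T %/ K) == i)%N]%SET.

(* The ordered draws without replacement of q time points from block i. *)
Definition draws (T K q : nat) (i : 'I_K) : {set {ffun 'I_q -> 'I_T}} :=
  [set f : {ffun 'I_q -> 'I_T} | injectiveb f && [forall j, f j \in block T i]]%SET.

(* The last cell gets the m - (q - 1) k <= k remaining items. *)
Definition cell_division (m k K : nat) (cell : 'I_K -> 'I_m -> 'I_(ncells m k)) :
    Prop :=
  forall (i : 'I_K) (j : 'I_(ncells m k)), (j.+1 < ncells m k)%N ->
    #|[set x | cell i x == j]%SET| = k.

(* [expl t j] is the permutation output if round t explores the j-th cell. *)
Definition explores (m k T K : nat) (cell : 'I_K -> 'I_m -> 'I_(ncells m k))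
    (expl : 'I_T -> 'I_(ncells m k) -> 'S_m) : Prop :=
  forall (i : 'I_K) (t : 'I_T) (x : 'I_m), t \in block T i ->
    (item_rank (expl t (cell i x)) x <= k)%N.

(* The transformed relevance of item x collected in block i: x is looked up at
   its rank in the top-k feedback of the round that explores its cell. *)
Definition estimate {R : realType} {m k T K : nat}
    (cell : 'I_K -> 'I_m -> 'I_(ncells m k))
    (expl : 'I_T -> 'I_(ncells m k) -> 'S_m) (rel : 'I_T -> 'I_m -> nat)
    (tau : 'I_K -> {ffun 'I_(ncells m k) -> 'I_T}) (i : 'I_K) (x : 'I_m) : R :=
  let t := tau i (cell i x) in
  let s := expl t (cell i x) in
  gain (nth 0%N (feedback k s (rel t)) (item_rank s x).-1).

(* The sum of the estimates of the blocks strictly before block i. *)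
Definition score {R : realType} {m k T K : nat}
    (cell : 'I_K -> 'I_m -> 'I_(ncells m k))
    (expl : 'I_T -> 'I_(ncells m k) -> 'S_m) (rel : 'I_T -> 'I_m -> nat)
    (tau : 'I_K -> {ffun 'I_(ncells m k) -> 'I_T}) (i : nat) (x : 'I_m) : R :=
  \sum_(l < K | (l < i)%N) estimate cell expl rel tau l x.

(* The permutation output at round t, for exploration time points [tau i j]
   and perturbations [p t x]. *)
Definition output {R : realType} {m k T K : nat}
    (cell : 'I_K -> 'I_m -> 'I_(ncells m k))
    (expl : 'I_T -> 'I_(ncells m k) -> 'S_m) (rel : 'I_T -> 'I_m -> nat)
    (tau : 'I_K -> {ffun 'I_(ncells m k) -> 'I_T}) (p : 'I_T -> 'I_m -> R)
    (t : 'I_T) : 'S_m :=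
  if [pick ij : 'I_K * 'I_(ncells m k) | tau ij.1 ij.2 == t] is Some ij
  then expl t ij.2
  else sort_perm
         (fun x => score cell expl rel tau (t %/ (T %/ K))%N x + p t x).

(* The joint law of the time points and of the perturbations.  Taking some of
   the sets to be [setT] gives the product rule for every subfamily. *)
Record learner_randomness {d : measure_display} {Om : measurableType d}
    {R : realType} (P : probability Om R) {m T K q : nat} (eps : R)
    (tau : 'I_K -> Om -> {ffun 'I_q -> 'I_T})
    (p : 'I_T -> 'I_m -> Om -> R) : Prop := LearnerRandomness {
  measurable_tau : forall i f, measurable (tau i @^-1` [set f]);
  measurable_p : forall t x, measurable_fun [set: Om] (p t x);
  uniform_tau : forall i f, P (tau i @^-1` [set f]) =
    ((f \in draws T q i)%:R / #|draws T q i|%:R)%:E;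
  uniform_p : forall t x (ab : 0 < eps^-1) (A : set R), measurable A ->
    P (p t x @^-1` A) = uniform_prob ab A;
  independent_tau_p : forall (B : 'I_K -> set {ffun 'I_q -> 'I_T})
      (A : 'I_T -> 'I_m -> set R), (forall t x, measurable (A t x)) ->
    P [set w | (forall i, B i (tau i w)) /\ (forall t x, A t x (p t x w))] =
    ((\prod_(i < K) P (tau i @^-1` B i)) *
     \prod_(t < T) \prod_(x < m) P (p t x @^-1` A t x))%E }.

Definition regret {d : measure_display} {Om : measurableType d}
    {R : realType} (P : probability Om R) {m T : nat}
    (rel : 'I_T -> 'I_m -> nat) (sigma : 'I_T -> Om -> 'S_m) : \bar R :=
  (* DCG is nonnegative, so the default value 0 of the maximum is harmless. *)
  ((\big[Num.max/0]_(s : 'S_m) \sum_(t < T) dcg s (rel t))%:E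
   - 'E_P[fun w => (\sum_(t < T) dcg (sigma t w) (rel t) : R)%R])%E.

Definition same_order {R : realType} (a x y : R) : Prop := y / a <= x <= a * y.

Definition blocks_scale {R : realType} (m k T : nat) : R :=
  m%:R `^ (1 / 3) * T%:R `^ (2 / 3) / (ncells m k)%:R `^ (2 / 3).

Definition eps_scale {R : realType} (n m K : nat) : R :=
  1 / ((2 ^+ n - 1) ^+ 2 * Num.sqrt (m * K)%:R).

Definition regret_scale {R : realType} (n m k T : nat) : R :=
  (2 ^+ n - 1) * m%:R `^ (4 / 3) * (ncells m k)%:R `^ (1 / 3) * T%:R `^ (2 / 3).

(* Regret at most [C * regret_scale] for n + 1 grades, for every number K of
   blocks within a factor a of [blocks_scale] and every eps within a factor a
   of [c * eps_scale].  The constants c and C cannot both be independent of n: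
   with m = k = 2, rel = (n, 0) in every round and eps = c * eps_scale, the
   regret for large T is at least of order (2^n - 1)^2 T^(2/3). *)
Definition regret_bound {R : realType} (n : nat) (a c C : R) : Prop :=
  forall (m k T K : nat) (eps : R),
  (0 < m)%N -> (0 < k)%N -> (0 < T)%N ->
  (K %| T)%N -> (ncells m k <= T %/ K)%N ->
  same_order a K%:R (blocks_scale m k T) ->
  same_order a eps (c * eps_scale n m K) ->
  forall (cell : 'I_K -> 'I_m -> 'I_(ncells m k))
    (expl : 'I_T -> 'I_(ncells m k) -> 'S_m),
  cell_division cell -> explores cell expl ->
  forall rel : 'I_T -> 'I_m -> nat, (forall t x, (rel t x <= n)%N) ->
  forall (d : measure_display) (Om : measurableType d) (P : probability Om R)
    (tau : 'I_K -> Om -> {ffun 'I_(ncells m k) -> 'I_T})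
    (p : 'I_T -> 'I_m -> Om -> R),
  learner_randomness P eps tau p ->
  (regret P rel (fun t w =>
     output cell expl rel (fun i => tau i w) (fun t x => p t x w) t)
   <= (C * regret_scale n m k T)%:E)%E.

(* Main.v *)
(* In block i the exploratory rounds collect an unbiased estimate of the mean
   transformed relevances of the block, independent of the earlier estimates
   and of the perturbations.  Conditionally on all exploration times, the
   leaders therefore play FTPL on K bounded rewards, with total gains that are
   K / T times those of the exploitation rounds in expectation.  FTPL has regret
   at most m / eps (be-the-leader, the perturbation acting as a round 0 reward)
   plus K eps (m b)^2 with b = 2^n - 1 (the cube [0, 1/eps]^m and its translate
   by a reward r differ by a volume fraction at most eps |r|_1).  Multiplying by
   T / K and adding the exploration loss K ceil(m/k) m b gives
     K ceil(m/k) m b + (T / K) (m / eps + K eps (m b)^2),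
   which the choices of K and eps balance. *)
Require Import Defs.
From mathcomp Require Import all_boot all_order all_algebra all_fingroup.
From mathcomp Require Import all_classical all_reals all_analysis.
From mathcomp Require Import measurable_realfun ring lra.
Set Implicit Arguments.
Unset Strict Implicit.
Unset Printing Implicit Defensive.
Import Order.TTheory GRing.Theory Num.Theory.
Local Open Scope classical_set_scope.
Local Open Scope ring_scope.

(** * Measures on tuples and finite-valued random variables *)

(** Rectangles are stable under intersection and generate the product sigma-algebra. As [m1] is
    finite, the constant sequence [setT] serves as the exhaustion required for uniqueness. *)
Lemma tuple_measure_unique {d} {T : measurableType d} {R : realType} (n : nat)
    (m1 m2 : {measure set (n.-tuple T) -> \bar R}) :
    (m1 setT < +oo)%E ->
    (forall A : 'I_n -> set T, (forall i, measurable (A i)) ->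
       m1 [set v | forall i, A i (tnth v i)] =
       m2 [set v | forall i, A i (tnth v i)]) ->
  forall E, measurable E -> m1 E = m2 E.
Proof.
move=> m1oo m12.
pose G := [set E : set (n.-tuple T) | exists2 A : 'I_n -> set T,
   forall i, measurable (A i) & E = [set v | forall i, A i (tnth v i)]].
have GT : G setT.
  exists (fun=> setT) => //; apply/esym; rewrite -subTset => v _ i //.
have Gm : G `<=` measurable.
  move=> _ [A mA ->].
  have -> : [set v | forall i, A i (tnth v i)] =
      \bigcap_(i in [set: 'I_n]) ((@tnth _ T ^~ i) @^-1` (A i)).
    by apply/seteqP; split=> v /= h i => [_|]; exact: h.
  apply: fin_bigcap_measurable => // i _.
  rewrite -[X in measurable X]setTI; exact: measurable_tnth.
have GI : setI_closed G.
  move=> _ _ [A mA ->] [B mB ->]; exists (fun i => A i `&` B i).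
    by move=> i; exact: measurableI.
  by apply/seteqP; split=> v /= => [[hA hB] i|h]; split=> // i; case: (h i).
move=> E mE.
apply: (@g_sigma_algebra_measure_unique _ R _ G Gm (fun=> setT)) => //.
- by rewrite bigcup_const.
- by move=> _ [A mA ->]; exact: m12.
(* The generators of the product sigma-algebra constrain one coordinate, hence are rectangles whose
   other sides are full. *)
move: E mE; apply: smallest_sub; first exact: smallest_sigma_algebra.
move=> E; rewrite -bigcup_seq => -[i _ [A mA <-]].
apply: sub_sigma_algebra; exists (fun j => if j == i then A else setT).
  by move=> j; case: ifP.
apply/seteqP; split=> v /=.
  by move=> [_ Av] j; case: eqP => // ->.
by move=> /(_ i); rewrite eqxx.
Qed.

Lemma lebesgue_measure_translation {R : realType} (c : R) (A : set R) :
  measurable A ->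
  lebesgue_measure ((fun x => x + c) @^-1` A) = lebesgue_measure A.
Proof.
move=> mA; apply/esym.
have mf : @measurable_fun _ _ (measurableTypeR R) (measurableTypeR R) setT
    (fun x : R => x + c).
  exact: measurable_funD.
pose f : measurableTypeR R -> measurableTypeR R := fun x => x + c.
rewrite -[RHS]/(pushforward lebesgue_measure f A).
apply: lebesgue_measure_unique => //= _ [[x y]] _ <-.
change (lebesgue_measure [set` `]x, y]] =
  lebesgue_measure ((fun z => z + c) @^-1` [set` `]x, y]])).
have -> : (fun z => z + c) @^-1` [set` `]x, y]] = [set` `]x - c, y - c]].
  by apply/seteqP; split=> z /=; rewrite !in_itv /= ltrBlDr lerBrDr.
rewrite !lebesgue_measure_itv /= !lte_fin ltrD2r.
by case: ifP => // _; rewrite -!EFinB; congr _%:E; ring.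
Qed.

(** * Uniform laws on an interval under translation *)

Section uniform_shift.
Context {R : realType} (a b : R) (ab : a < b).

Lemma uniform_probE (A : set R) : measurable A ->
  uniform_prob ab A = ((b - a)^-1%:E * lebesgue_measure (A `&` `[a, b]))%E.
Proof.
move=> mA; rewrite /uniform_prob integral_uniform_pdf.
rewrite (eq_integral (fun=> (b - a)^-1%:E)); last first.
  move=> x /[!inE] -[_ /=]; rewrite in_itv /= => xab.
  by rewrite /uniform_pdf xab.
by rewrite integral_cst//; exact: measurableI.
Qed.

(** Translation by [c] carries [[a, b - c]] onto [[a + c, b]], and the density is constant on
    [[a, b]], which contains both. *)
Lemma uniform_prob_shift (c : R) (A : set R) : 0 <= c -> measurable A ->
  uniform_prob ab ((fun x => x + c) @^-1` A `&` `]-oo, b - c]) =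
  uniform_prob ab (A `&` `[a + c, +oo[).
Proof.
move=> c0 mA.
have mf : measurable_fun setT (fun x : R => x + c) by exact: measurable_funD.
have mA' : measurable ((fun x => x + c) @^-1` A).
  by rewrite -[X in measurable X]setTI; exact: mf.
rewrite !uniform_probE; [|exact: measurableI..].
congr (_ * _)%E; rewrite -[RHS](@lebesgue_measure_translation _ c).
  congr lebesgue_measure; apply/seteqP; split=> x /=;
  rewrite !in_itv /= !andbT => -[[Ax h1] /andP[h2 h3]];
  split; [split=> //; lra|apply/andP; split; lra
         |split=> //; lra|apply/andP; split; lra].
by apply: measurableI => //; exact: measurableI.
Qed.

Lemma uniform_prob_tail (c : R) : 0 <= c ->
  (uniform_prob ab [set x | (b - c < x)%R] <= (c / (b - a))%:E)%E.
Proof.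
move=> c0; rewrite -set_itvoy uniform_probE //.
rewrite mulrC EFinM lee_pmul2l //; last first.
  by rewrite lte_fin invr_gt0 subr_gt0.
apply: (@le_trans _ _ (lebesgue_measure `]b - c, b])).
  apply: le_measure; rewrite ?inE //=; first exact: measurableI.
  by move=> x /=; rewrite !in_itv /= andbT => -[h1 /andP[h2 h3]]; apply/andP; split.
rewrite lebesgue_measure_itv /=; case: ifP => _; last by rewrite lee_fin.
by rewrite -EFinB lee_fin; lra.
Qed.

End uniform_shift.

(** * Expectations of finite-valued random variables *)

Section discrete_variable.
Context {d} {T : measurableType d} {R : realType} (P : probability T R).
Context {F : finType} (X : T -> F).
Hypothesis mX : forall v, measurable (X @^-1` [set v]).

Lemma measurable_preimage_finType (Y : set F) : measurable (X @^-1` Y).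
Proof.
have -> : X @^-1` Y = \bigcup_(v in Y) X @^-1` [set v].
  by apply/seteqP; split=> w /=; [move=> h; exists (X w)|case=> v Yv ->].
by apply: fin_bigcup_measurable.
Qed.

Lemma expectation_finType (phi : F -> R) :
  ('E_P[fun w => phi (X w)] = (\sum_v phi v * fine (P (X @^-1` [set v])))%:E)%E.
Proof.
have finP v : P (X @^-1` [set v]) \is a fin_num by exact: fin_num_measure.
have -> : (fun w => phi (X w)) =
    (fun w => \sum_v phi v * \1_(X @^-1` [set v]) w).
  apply/funext => w; rewrite (bigD1 (X w)) //= big1 ?addr0.
    by rewrite indicE mem_set // mulr1.
  move=> v vX; rewrite indicE memNset ?mulr0 // => h.
  by rewrite -h eqxx in vX.
rewrite unlock.
under eq_integral do rewrite -sumEFin.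
rewrite integral_sum //; last first.
  move=> v; under eq_fun do rewrite EFinM; apply: integrableZl => //.
  exact: integrable_indic.
rewrite -sumEFin; apply: eq_bigr => v _.
under eq_integral do rewrite EFinM.
rewrite integralZl //; last exact: integrable_indic.
by rewrite integral_indic // setIT EFinM fineK.
Qed.

Lemma prob_finType_ge0 v : 0 <= fine (P (X @^-1` [set v])).
Proof. exact: fine_ge0. Qed.

Lemma sum_prob_finType : \sum_v fine (P (X @^-1` [set v])) = 1.
Proof.
apply/EFin_inj; have := expectation_finType (fun=> 1).
under [in X in _ = X -> _]eq_bigr do rewrite mul1r.
by move=> <-; rewrite -(expectation_cst P 1).
Qed.

Lemma prob_finType_set (Y : {set F}) :
  \sum_(v in Y) fine (P (X @^-1` [set v])) = fine (P (X @^-1` [set` Y])).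
Proof.
apply/EFin_inj; rewrite fineK; last first.
  by apply: fin_num_measure; exact: measurable_preimage_finType.
rewrite -(expectation_indic P (measurable_preimage_finType [set` Y])).
transitivity ('E_P[fun w => (X w \in Y)%:R])%E.
  rewrite (expectation_finType (fun v => (v \in Y)%:R)) big_mkcond /=.
  by congr _%:E; apply: eq_bigr => v _; case: ifP => _; rewrite ?mul1r ?mul0r.
congr ('E_P[_])%E; apply/funext => w; rewrite indicE; congr (nat_of_bool _)%:R.
by apply/idP/idP => [h|/set_mem //]; exact: mem_set.
Qed.

(** A value [v] with [phi v < c] is attained only inside the null set [N], so it carries no
    weight. *)
Lemma ae_expectation_finType_ge (phi : F -> R) (c : R) (N : set T) :
  measurable N -> P N = 0%E -> (forall w, ~ N w -> c <= phi (X w)) ->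
  c <= \sum_v phi v * fine (P (X @^-1` [set v])).
Proof.
move=> mN N0 h; rewrite -[c]mulr1 -sum_prob_finType mulr_sumr.
apply: ler_sum => v _; have [cv|vc] := leP c (phi v).
  by rewrite ler_wpM2r // prob_finType_ge0.
suff -> : P (X @^-1` [set v]) = 0%E by rewrite !mulr0.
apply/eqP; rewrite -measure_le0 -N0; apply: le_measure; rewrite ?inE //.
move=> w /= Xw; apply: contrapT => /h; rewrite Xw; lra.
Qed.

End discrete_variable.

Section discrete_family.
Context {d} {T : measurableType d} {R : realType} (P : probability T R).
Context {I F : finType} (X : I -> T -> F).
Hypothesis mX : forall i v, measurable (X i @^-1` [set v]).

(** Packing the family into a single finite-valued variable reduces sums over [I] to the
    one-variable lemmas, whatever the dependence between the [X i]. *)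
Let joint w : {ffun I -> F} := [ffun i => X i w].

Let measurable_joint v : measurable (joint @^-1` [set v]).
Proof.
have -> : joint @^-1` [set v] = \bigcap_(i in setT) X i @^-1` [set v i].
  apply/seteqP; split=> w /=; first by move=> <- i _ /=; rewrite ffunE.
  by move=> h; apply/ffunP => i; rewrite ffunE; exact: h.
by apply: fin_bigcap_measurable.
Qed.

Let sum_joint (phi : I -> F -> R) :
  \sum_i \sum_v phi i v * fine (P (X i @^-1` [set v])) =
  \sum_(v : {ffun I -> F}) (\sum_i phi i (v i)) * fine (P (joint @^-1` [set v])).
Proof.
under [RHS]eq_bigr do rewrite mulr_suml.
rewrite [RHS]exchange_big; apply: eq_bigr => i _; apply/EFin_inj.
rewrite -(expectation_finType P (mX i)).
rewrite -(expectation_finType P measurable_joint (fun v => phi i (v i))).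
by congr ('E_P[_])%E; apply/funext => w; rewrite ffunE.
Qed.

Lemma expectation_sum_finType (phi : I -> F -> R) :
  ('E_P[fun w => (\sum_i phi i (X i w))%R] =
   (\sum_i \sum_v phi i v * fine (P (X i @^-1` [set v])))%:E)%E.
Proof.
rewrite sum_joint -(expectation_finType P measurable_joint).
by congr ('E_P[_])%E; apply/funext => w; apply: eq_bigr => i _; rewrite ffunE.
Qed.

Lemma ae_expectation_sum_finType_ge (phi : I -> F -> R) (c : R) (N : set T) :
    measurable N -> P N = 0%E -> (forall w, ~ N w -> c <= \sum_i phi i (X i w)) ->
  c <= \sum_i \sum_v phi i v * fine (P (X i @^-1` [set v])).
Proof.
move=> mN N0 h; rewrite sum_joint.
apply: (ae_expectation_finType_ge measurable_joint mN N0) => w /h.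
by under [X in _ -> is_true (_ <= X)]eq_bigr do rewrite ffunE.
Qed.

End discrete_family.

(** * Translations of the uniform cube *)

Definition translate {R : realType} {m : nat} (x : 'I_m) (c : R)
    (v : m.-tuple R) : m.-tuple R :=
  [tuple tnth v y + (if y == x then c else 0) | y < m].

Section uniform_cube.
Context {R : realType} (a b : R) (ab : a < b) {m : nat}.
(** [L] is known through its values on rectangles, so the law of a perturbation vector under [P] can
    be substituted for it directly. *)
Variable L : {measure set (m.-tuple R) -> \bar R}.
Hypothesis L_rect : forall A : 'I_m -> set R, (forall x, measurable (A x)) ->
  L [set v | forall x, A x (tnth v x)] = (\prod_(x < m) uniform_prob ab (A x))%E.

Let L_setT : L setT = 1%E.
Proof.
pose A := fun _ : 'I_m => [set: R].
rewrite -(_ : [set v | forall x, A x (tnth v x)] = setT).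
  rewrite L_rect; last by move=> x; exact: measurableT.
  by apply: big1 => x _; exact: probability_setT.
by rewrite -subTset => v _ i.
Qed.

Let measurable_translate (x : 'I_m) (c : R) :
  measurable_fun setT (@translate R m x c).
Proof.
apply/measurable_fun_tnthP => y.
rewrite (_ : _ \o _ =
    (fun v : m.-tuple R => tnth v y + (if y == x then c else 0))).
  by apply: measurable_funD => //; exact: measurable_tnth.
by apply/funext => v /=; rewrite tnth_mktuple.
Qed.

(* The cube and its translate overlap except on a slab of relative width
   [c / (b - a)]. *)
Lemma uniform_cube_translate x c (E : set (m.-tuple R)) :
    0 <= c -> measurable E ->
  (L (translate x c @^-1` E) <= L E + (c / (b - a))%:E)%E.
Proof.
move=> c0 mE.
have mtnth y (A : set R) : measurable A ->
    measurable [set v : m.-tuple R | A (tnth v y)].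
  by move=> mA; rewrite -[X in measurable X]setTI; exact: measurable_tnth.
(* [lo] holds the points of the cube that stay in it after the translation, and [hi] holds their
   images. *)
pose lo := [set v : m.-tuple R | `]-oo, b - c]%classic (tnth v x)].
pose hi := [set v : m.-tuple R | `[a + c, +oo[%classic (tnth v x)].
have mlo : measurable lo by exact: mtnth.
have mhi : measurable hi by exact: mtnth.
have mfE : measurable (translate x c @^-1` E).
  by rewrite -[X in measurable X]setTI; exact: measurable_translate.
(* Both sides are finite measures in [E], so rectangles suffice. There only side [x] differs, and it
   is handled by the one-dimensional shift. *)
have key : L (translate x c @^-1` E `&` lo) = L (E `&` hi).
  rewrite -[LHS]/(pushforward (mrestr L mlo) (translate x c) E) -[RHS]/(mrestr L mhi E).
  apply: tuple_measure_unique => //.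
    rewrite /= /pushforward /mrestr preimage_setT setTI.
    rewrite (@le_lt_trans _ _ 1%E) ?ltry // -L_setT.
    by apply: le_measure; rewrite ?inE.
  move=> A mA.
  change (L (translate x c @^-1` [set v | forall i, A i (tnth v i)] `&` lo) =
    L ([set v | forall i, A i (tnth v i)] `&` hi)).
  have mB : measurable ((fun z => z + c) @^-1` A x `&` `]-oo, b - c]).
    apply: measurableI => //; rewrite -[X in measurable X]setTI.
    by apply: measurable_funD => //.
  have mC : measurable (A x `&` `[a + c, +oo[) by exact: measurableI.
  pose B i := if i == x then (fun z => z + c) @^-1` A x `&` `]-oo, b - c]
              else A i.
  pose C i := if i == x then A x `&` `[a + c, +oo[ else A i.
  transitivity (L [set v | forall i, B i (tnth v i)]).
    congr (L _); apply/seteqP; split=> v /=.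
      move=> [h1 h2] i; move: (h1 i); rewrite tnth_mktuple /B.
      by case: eqP => [->|_]; rewrite ?addr0.
    move=> h; split; last by move: (h x); rewrite /B eqxx => -[].
    move=> i; rewrite tnth_mktuple; move: (h i); rewrite /B.
    by case: eqP => [->|_]; rewrite ?addr0 // => -[].
  transitivity (L [set v | forall i, C i (tnth v i)]); last first.
    congr (L _); apply/seteqP; split=> v /=.
      move=> h; split; last by move: (h x); rewrite /C eqxx => -[].
      by move=> i; move: (h i); rewrite /C; case: eqP => [->|_] // -[].
    by move=> [h1 h2] i; rewrite /C; case: eqP => [->|_].
  rewrite !L_rect; try by move=> i; rewrite /B /C; case: ifP.
  rewrite (bigD1 x) //= [RHS](bigD1 x) //= /B /C eqxx uniform_prob_shift //.
  by congr (_ * _)%E; apply: eq_bigr => i /negPf ->.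
have tail : (L (~` lo) <= (c / (b - a))%:E)%E.
  apply: le_trans (uniform_prob_tail ab c0).
  pose D i := if i == x then `]b - c, +oo[%classic else [set: R].
  rewrite -set_itvoy (_ : ~` lo = [set v | forall i, D i (tnth v i)]).
    rewrite L_rect; last by move=> i; rewrite /D; case: ifP.
    rewrite (bigD1 x) //= /D eqxx big1 ?mule1 // => i /negPf ->.
    exact: probability_setT.
  apply/seteqP; split=> v /=; rewrite /lo /= in_itv /=.
    move=> /negP; rewrite -ltNge /D => h i; case: eqP => [->|//].
    by rewrite /= in_itv /= h.
  by move=> /(_ x); rewrite /D eqxx /= in_itv /= andbT ltNge => /negP.
apply: (@le_trans _ _ (L (translate x c @^-1` E `&` lo) + L (~` lo))%E).
  rewrite -[X in (_ <= X)%E]measureU; last 3 first.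
  - exact: measurableI.
  - exact: measurableC.
  - by rewrite -setIA setICr setI0.
  apply: le_measure; rewrite ?inE //.
    by apply: measurableU; [exact: measurableI|exact: measurableC].
  by move=> v h; have [?|?] := pselect (lo v); [left|right].
rewrite key leeD //; apply: le_measure; rewrite ?inE //.
exact: measurableI.
Qed.

End uniform_cube.

(** The minimizer, ties included, depends on [y] only through the finite table of comparisons
    between costs, and each comparison is a measurable event. *)
Lemma measurable_sort_perm {d} {V : measurableType d} {R : realType} (m : nat)
    (y : V -> 'I_m -> R) (s : 'S_m) :
  (forall x, measurable_fun setT (fun v => y v x)) ->
  measurable [set v | sort_perm (y v) = s].
Proof.
move=> my.
pose cost v (s : 'S_m) := \sum_(x < m) (item_rank s x)%:R * y v x.
have mcost s' : measurable_fun setT (cost^~ s').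
  by apply: measurable_sum => x; apply: measurable_funM.
pose b v := [ffun ss : 'S_m * 'S_m => cost v ss.1 <= cost v ss.2].
(* The predicate copies the unfolded [arg min], so the choice operator breaks ties in the same
   way. *)
pose G (c : {ffun 'S_m * 'S_m -> bool}) : 'S_m :=
  odflt 1%g [pick s | true && [forall (j | true), c (s, j)]].
have bG v : sort_perm (y v) = G (b v).
  rewrite /sort_perm /G /Order.arg_min /extremum; congr odflt.
  apply: eq_pick => s' /=.
  by apply: eq_forallb => j; rewrite ffunE.
have -> : [set v | sort_perm (y v) = s] = b @^-1` [set c | G c = s].
  by apply/seteqP; split=> v /=; rewrite bG.
apply: (@measurable_preimage_finType _ _ _ b) => c.
have -> : b @^-1` [set c] =
    \bigcap_(ss in setT) (fun v => cost v ss.1 <= cost v ss.2) @^-1` [set c ss].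
  apply/seteqP; split=> v /=; first by move=> <- ss _ /=; rewrite ffunE.
  by move=> h; apply/ffunP => ss; rewrite ffunE; exact: h.
apply: fin_bigcap_measurable => [|ss _]; first exact: finite_finset.
by rewrite -[X in measurable X]setTI; apply: measurable_fun_ler.
Qed.

(** * Leaders maximize the discounted gain *)

Section discount.
Context {R : realType}.

Lemma log2_ge1 (x : R) : 2 <= x -> 1 <= log2 x.
Proof.
move=> x2; have l2 : 0 < ln (2 : R) by rewrite ln_gt0 // ltr1n.
by rewrite /log2 ler_pdivlMr // mul1r ler_ln // posrE; lra.
Qed.

Lemma le_log2 (x y : R) : 0 < x -> x <= y -> log2 x <= log2 y.
Proof.
move=> x0 xy; have l2 : 0 < ln (2 : R) by rewrite ln_gt0 // ltr1n.
rewrite /log2; apply: ler_wpM2r; first by rewrite invr_ge0 ltW.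
by rewrite ler_ln // posrE; lra.
Qed.

Definition discount (j : nat) : R := (log2 (1 + j.+1%:R))^-1.

Lemma log2_rank_ge1 (j : nat) : 1 <= log2 (1 + j.+1%:R : R).
Proof. by apply: log2_ge1; rewrite -natr1; have := ler0n R j; lra. Qed.

Lemma discount_ge0 j : 0 <= discount j.
Proof. by rewrite invr_ge0 (le_trans ler01) // log2_rank_ge1. Qed.

Lemma discount_le1 j : discount j <= 1.
Proof. by rewrite invf_le1 ?log2_rank_ge1 // (lt_le_trans ltr01) // log2_rank_ge1. Qed.

Lemma discountS_le j : discount j.+1 <= discount j.
Proof.
have h k : log2 (1 + k.+1%:R : R) \is Num.pos.
  by rewrite posrE (lt_le_trans ltr01) // log2_rank_ge1.
rewrite /discount lef_pV2 // le_log2 //; by rewrite lerD2l ler_nat.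
Qed.

End discount.

(** * The rearrangement inequality *)

Section rearrangement.
Context {R : realType} (m : nat).

(* Comparison with the threshold value [z j]: the positive parts of
   [z - z j] are supported on the indices below [j]. *)
Lemma sorted_partial_sum (z : 'I_m -> R) (s : 'S_m) (j : 'I_m) :
  {homo z : i k / (i <= k)%N >-> k <= i} ->
  \sum_(i < m | (i <= j)%N) z (s i) <= \sum_(i < m | (i <= j)%N) z i.
Proof.
move=> zs; rewrite -subr_ge0.
have shift (u : 'I_m -> R) : \sum_(i < m | (i <= j)%N) u i =
    \sum_(i < m | (i <= j)%N) (u i - z j) + \sum_(i < m | (i <= j)%N) z j.
  by rewrite -big_split; apply: eq_bigr => i _; rewrite /= subrK.
rewrite (shift z) (shift (fun i => z (s i))) opprD addrACA subrr addr0 subr_ge0.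
apply: (@le_trans _ _ (\sum_(i < m) Num.max (z (s i) - z j) 0)).
  rewrite [X in _ <= X](bigID (fun i : 'I_m => (i <= j)%N)) /= -[X in X <= _]addr0.
  apply: lerD; first by apply: ler_sum => i _; rewrite le_max lexx.
  by apply: sumr_ge0 => i _; rewrite le_max lexx orbT.
have -> : \sum_(i < m) Num.max (z (s i) - z j) 0 =
    \sum_(i < m) Num.max (z i - z j) 0.
  by rewrite [RHS](reindex_inj (@perm_inj _ s)).
rewrite (bigID (fun i : 'I_m => (i <= j)%N)) /= [X in _ + X]big1 ?addr0.
  apply: ler_sum => i ij; rewrite ge_max lexx subr_ge0; exact: zs.
move=> i; rewrite -ltnNge => /ltnW ij; apply/max_idPr.
by rewrite subr_le0; exact: zs.
Qed.

(** Abel summation turns both sides into combinations of partial sums with the same nonnegative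
    coefficients, and [sorted_partial_sum] compares the partial sums. *)
Lemma rearrangement (w : nat -> R) (z : 'I_m -> R) (s : 'S_m) :
    (forall j, 0 <= w j) -> (forall j, w j.+1 <= w j) ->
    {homo z : i k / (i <= k)%N >-> k <= i} ->
  \sum_(i < m) z (s i) * w i <= \sum_(i < m) z i * w i.
Proof.
move=> w0 wS zs.
(* Resetting the weight to 0 at [m] absorbs the boundary term of the summation by parts into the
   last increment. *)
pose W j := if j == m then 0 else w j.
have W_m : W m = 0 by rewrite /W eqxx.
have W_lt (i : 'I_m) : W i = w i by rewrite /W ltn_eqF.
have abel (u : 'I_m -> R) : \sum_(i < m) u i * w i =
    \sum_(j < m) (W j - W j.+1) * \sum_(i < m | (i <= j)%N) u i.
  under [RHS]eq_bigr do rewrite mulr_sumr.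
  rewrite (exchange_big_dep xpredT) //=; apply: eq_bigr => i _.
  rewrite -mulr_suml mulrC; congr (_ * _).
  rewrite -(big_geq_mkord i m xpredT (fun j => W j - W j.+1)) /=.
  rewrite (telescope_sumr_eq (fun j => - W j)) ?W_m ?W_lt; first by ring.
    exact: ltnW.
  by move=> j _; ring.
rewrite !abel; apply: ler_sum => j _; apply: ler_wpM2l.
  by rewrite W_lt /W; case: ifP => _; rewrite ?subr0 // subr_ge0.
exact: sorted_partial_sum.
Qed.

End rearrangement.

Section linear_dcg.
Context {R : realType} {m : nat}.
Implicit Types (s : 'S_m) (y : 'I_m -> R).

(** DCG extended to arbitrary real rewards: [dcg s r] is the case [y x = gain (r x)]. Linearity in
    [y] lets scores, estimates and perturbations be added. *)
Definition linear_dcg s y : R := \sum_(x < m) y x / log2 (1 + (item_rank s x)%:R).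

Lemma linear_dcgE s y : linear_dcg s y = \sum_(x < m) y x * discount ((s^-1)%g x).
Proof. by []. Qed.

Lemma linear_dcg_rankE s y : linear_dcg s y = \sum_(j < m) y (s j) * discount j.
Proof.
rewrite linear_dcgE (reindex_inj (@perm_inj _ s)); apply: eq_bigr => j _.
by rewrite permK.
Qed.

Lemma linear_dcgD s y1 y2 :
  linear_dcg s (fun x => y1 x + y2 x) = linear_dcg s y1 + linear_dcg s y2.
Proof. by rewrite -big_split; apply: eq_bigr => x _; rewrite mulrDl. Qed.

Lemma linear_dcg_sum (I : finType) (A : pred I) s (y : I -> 'I_m -> R) :
  linear_dcg s (fun x => \sum_(i | A i) y i x) = \sum_(i | A i) linear_dcg s (y i).
Proof. by rewrite exchange_big; apply: eq_bigr => x _; rewrite mulr_suml. Qed.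

Lemma linear_dcg_ge0 s y : (forall x, 0 <= y x) -> 0 <= linear_dcg s y.
Proof.
move=> y0; rewrite linear_dcgE; apply: sumr_ge0 => x _.
by rewrite mulr_ge0 ?discount_ge0.
Qed.

Lemma linear_dcg_le s y (b : R) :
  (forall x, 0 <= y x <= b) -> linear_dcg s y <= m%:R * b.
Proof.
move=> yb; rewrite linear_dcgE mulr_natl -[X in _ *+ X]card_ord -sumr_const.
apply: ler_sum => x _; have /andP[y0 y1] := yb x.
by rewrite (le_trans _ y1) // ler_piMr // discount_le1.
Qed.

(** Exchanging the items at ranks [i < k] changes the cost by [k - i] times the difference of their
    scores, which minimality forces to be nonnegative. *)
Lemma sort_perm_sorted y :
  {homo (fun j => y (sort_perm y j)) : i k / (i <= k)%N >-> k <= i}.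
Proof.
rewrite /sort_perm; case: arg_minP => // s _ smin i k ik.
have := smin (tperm i k * s)%g isT.
have cost s' : \sum_(x < m) (item_rank s' x)%:R * y x =
    \sum_(j < m) j.+1%:R * y (s' j).
  rewrite (reindex_inj (@perm_inj _ s')); apply: eq_bigr => j _.
  by rewrite /item_rank permK.
have [-> //|nik] := eqVneq i k.
have {}ik : (i < k)%N by rewrite ltn_neqAle ik andbT.
rewrite !cost (bigD1 i) //= (bigD1 k) 1?eq_sym //=.
rewrite [X in _ <= X](bigD1 i) //= [X in _ <= _ + X](bigD1 k) 1?eq_sym //=.
rewrite !permM tpermL tpermR.
under [X in _ <= _ + (_ + X)]eq_bigr => j /andP[ji jk].
  rewrite permM tpermD 1?eq_sym //; over.
rewrite !addrA lerD2r.
have : (i.+1%:R < k.+1%:R :> R) by rewrite ltr_nat.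
nra.
Qed.

(** [M] minimizes a cost linear in the ranks, yet it also maximizes the discounted gain: it sorts
    the scores in decreasing order, and the discounts decrease with the rank. *)
Lemma sort_perm_max s y : linear_dcg s y <= linear_dcg (sort_perm y) y.
Proof.
set s0 := sort_perm y; rewrite !linear_dcg_rankE.
have -> : \sum_(j < m) y (s j) * discount j =
    \sum_(j < m) y (s0 ((s * s0^-1)%g j)) * discount j.
  by apply: eq_bigr => j _; rewrite permM permKV.
apply: (rearrangement _ (fun i => @discount_ge0 R i) (fun i => @discountS_le R i)).
exact: sort_perm_sorted.
Qed.

(* Be-the-leader: with the perturbation counted as a round 0 reward, the leader
   of the rewards seen so far, current one included, has no regret. *)
Lemma be_the_leader (S r : nat -> 'I_m -> R) (q : 'I_m -> R) (b : R) (n : nat) s :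
    (forall x, S 0 x = 0) -> (forall i x, S i.+1 x = S i x + r i x) ->
    (forall x, 0 <= q x <= b) ->
  linear_dcg s (S n) - m%:R * b <=
  \sum_(i < n) linear_dcg (sort_perm (fun x => S i.+1 x + q x)) (r i).
Proof.
move=> S0 SS qb.
(* The value [h i] of the leader telescopes. Leader [i.+1] does no better than leader [i] on
   [S i + q], so each increment is at most the gain of leader [i.+1] on [r i]. *)
pose h i := linear_dcg (sort_perm (fun x => S i x + q x)) (fun x => S i x + q x).
apply: (@le_trans _ _ (h n - h 0%N)).
  apply: lerB.
    apply: le_trans (sort_perm_max s _); rewrite linear_dcgD lerDl.
    by apply: linear_dcg_ge0 => x; case/andP: (qb x).
  by apply: linear_dcg_le => x; rewrite S0 add0r.
rewrite -(telescope_sumr h (leq0n n)) big_mkord; apply: ler_sum => i _.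
rewrite lerBlDr /h addrC.
apply: le_trans (lerD (sort_perm_max
  (sort_perm (fun x => S i.+1 x + q x)) (fun x => S i x + q x)) (lexx _)).
rewrite -linear_dcgD; apply: ler_sum => x _; rewrite SS.
by rewrite addrAC.
Qed.

End linear_dcg.

(** * Follow the perturbed leader *)

Section learner.
Context {d : measure_display} {Om : measurableType d} {R : realType}.
Context (P : probability Om R) {m T K q : nat} (eps : R).
Context (tau : 'I_K -> Om -> {ffun 'I_q -> 'I_T}) (p : 'I_T -> 'I_m -> Om -> R).
Hypothesis H : learner_randomness P eps tau p.
Hypothesis eps_gt0 : 0 < eps.

Let inv_eps_gt0 : 0 < eps^-1. Proof. by rewrite invr_gt0. Qed.
Let U := uniform_prob inv_eps_gt0.

Definition noise (t : 'I_T) (w : Om) : m.-tuple R := [tuple p t x w | x < m].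

Let measurable_noise t : measurable_fun setT (noise t).
Proof.
apply/measurable_fun_tnthP => x.
rewrite (_ : _ \o _ = p t x); first exact: (measurable_p H).
by apply/funext => w /=; rewrite tnth_mktuple.
Qed.

Definition draw_event (f : 'I_K -> {ffun 'I_q -> 'I_T}) : set Om :=
  [set w | forall i, tau i w = f i].

Lemma measurable_draw_event f : measurable (draw_event f).
Proof.
have -> : draw_event f = \bigcap_(i in setT) tau i @^-1` [set f i].
  by apply/seteqP; split=> w /= h i; [move=> _; exact: h|exact: h].
apply: fin_bigcap_measurable => // i _; exact: (measurable_tau H).
Qed.

(** Leaving the perturbations of all rounds but [t] unconstrained in the product rule isolates round
    [t] together with the draws. *)
Let uniform_rect (t : 'I_T) (B : 'I_K -> set {ffun 'I_q -> 'I_T})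
    (A : 'I_m -> set R) : (forall x, measurable (A x)) ->
  P ([set w | forall i, B i (tau i w)] `&`
     noise t @^-1` [set v | forall x, A x (tnth v x)]) =
  (\prod_(i < K) P (tau i @^-1` B i) * \prod_(x < m) U (A x))%E.
Proof.
move=> mA; pose C t' x := if t' == t then A x else setT.
have mC t' x : measurable (C t' x) by rewrite /C; case: ifP.
have := independent_tau_p H B mC.
have -> : (\prod_(t' < T) \prod_(x < m) P (p t' x @^-1` C t' x) =
    \prod_(x < m) U (A x))%E.
  rewrite (bigD1 t) //= [X in (_ * X)%E]big1 ?mule1; last first.
    move=> t' /negPf tt'; rewrite big1 // => x _.
    by rewrite /C tt' preimage_setT probability_setT.
  apply: eq_bigr => x _; rewrite /C eqxx.
  exact: (uniform_p H).
move=> <-; congr (P _); apply/seteqP; split=> w /=.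
  move=> [h1 h2]; split=> // t' x; rewrite /C; case: eqP => // ->.
  by move: (h2 x); rewrite tnth_mktuple.
move=> [h1 h2]; split=> // x; rewrite tnth_mktuple.
by move: (h2 t x); rewrite /C eqxx.
Qed.

Let noise_rect t (A : 'I_m -> set R) : (forall x, measurable (A x)) ->
  P (noise t @^-1` [set v | forall x, A x (tnth v x)]) =
  (\prod_(x < m) U (A x))%E.
Proof.
move=> mA; have := uniform_rect t (fun=> setT) mA.
rewrite [X in (X * _)%E]big1 ?mul1e; last first.
  by move=> i _; rewrite preimage_setT probability_setT.
by move=> <-; congr (P _); apply/seteqP; split=> w // -[].
Qed.

Lemma prob_draw_event (t : 'I_T) f :
  P (draw_event f) = (\prod_(i < K) P (tau i @^-1` [set f i]))%E.
Proof.
pose A := fun _ : 'I_m => [set: R].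
have mA x : measurable (A x) by exact: measurableT.
have := uniform_rect t (fun i => [set f i]) mA.
rewrite [X in (_ * X)%E]big1 ?mule1; last first.
  by move=> x _; exact: probability_setT.
by move=> <-; congr (P _); apply/seteqP; split=> w // -[].
Qed.

(** The perturbations are independent of the draws and have the same law in every round, so the
    round [t0] on the right is arbitrary. *)
Let noise_joint t t0 f E : measurable E ->
  P (draw_event f `&` noise t @^-1` E) =
  (P (draw_event f) * P (noise t0 @^-1` E))%E.
Proof.
move=> mE; have mf := measurable_draw_event f.
have Pf0 : 0 <= fine (P (draw_event f)) by exact: fine_ge0.
have PfE : (fine (P (draw_event f)))%:E = P (draw_event f).
  by rewrite fineK // fin_num_measure.
rewrite setIC -PfE.
rewrite -[LHS]/(pushforward (mrestr P mf) (noise t) E).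
(* The right side is presented as the law of [noise t0] scaled by the constant [r], so that
   uniqueness of measures extends the identity from rectangles to [E]. *)
pose r := NngNum Pf0.
pose L : {measure set (m.-tuple R) -> \bar R} := pushforward P (noise t0).
rewrite -[RHS]/(mscale r (L (measurable_noise t0)) E).
apply: tuple_measure_unique => //.
  change (P (noise t @^-1` setT `&` draw_event f) < +oo)%E.
  by rewrite preimage_setT setTI -PfE ltry.
move=> A mA.
change (P (noise t @^-1` [set v | forall i, A i (tnth v i)] `&` draw_event f) =
  (fine (P (draw_event f)))%:E *
  P (noise t0 @^-1` [set v | forall i, A i (tnth v i)]))%E.
rewrite PfE noise_rect // (prob_draw_event t) setIC.
exact: uniform_rect.
Qed.

Definition leader (S : 'I_m -> R) (t : 'I_T) (w : Om) : 'S_m :=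
  sort_perm (fun x => S x + p t x w).

Let leader_set S s : set (m.-tuple R) :=
  [set v | sort_perm (fun x => S x + tnth v x) = s].

Let leaderE S t w : leader S t w = sort_perm (fun x => S x + tnth (noise t w) x).
Proof. by congr sort_perm; apply/funext => x; rewrite tnth_mktuple. Qed.

Let measurable_leader_set S s : measurable (leader_set S s).
Proof.
apply: measurable_sort_perm => x; apply: measurable_funD => //.
exact: measurable_tnth.
Qed.

Lemma measurable_leader S t s : measurable (leader S t @^-1` [set s]).
Proof.
have -> : leader S t @^-1` [set s] = noise t @^-1` (leader_set S s).
  by apply/seteqP; split=> w /=; rewrite leaderE.
by rewrite -[X in measurable X]setTI; exact: measurable_noise.
Qed.

Definition leader_law (t : 'I_T) (S : 'I_m -> R) (s : 'S_m) : R :=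
  fine (P (leader S t @^-1` [set s])).

Lemma leader_law_ge0 t S s : 0 <= leader_law t S s.
Proof. exact: prob_finType_ge0. Qed.

Lemma sum_leader_law t S : \sum_s leader_law t S s = 1.
Proof. exact: (sum_prob_finType _ (measurable_leader S t)). Qed.

(** Once the draws are fixed the scores are constants [S]. The output then has the leader law for
    [S], computed at one reference round [t0] for all rounds. *)
Lemma leader_draw_joint t t0 f S s :
  P (draw_event f `&` leader S t @^-1` [set s]) =
  (P (draw_event f) * (leader_law t0 S s)%:E)%E.
Proof.
rewrite /leader_law fineK; last first.
  by apply: fin_num_measure; exact: measurable_leader.
have E t' : leader S t' @^-1` [set s] = noise t' @^-1` (leader_set S s).
  by apply/seteqP; split=> w /=; rewrite leaderE.
by rewrite !E; exact: noise_joint.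
Qed.

(** Raising the score of [x0] by [c] amounts to translating the perturbation by [c] along [x0],
    where the cube has side [eps^-1]. *)
Let leader_law_bump t S x0 c (Z : {set 'S_m}) : 0 <= c ->
  \sum_(s in Z) leader_law t (fun x => S x + (if x == x0 then c else 0)) s <=
  \sum_(s in Z) leader_law t S s + eps * c.
Proof.
move=> c0; rewrite !prob_finType_set; [|exact: measurable_leader..].
pose E := [set v : m.-tuple R | sort_perm (fun x => S x + tnth v x) \in Z].
have mE : measurable E.
  apply: (@measurable_preimage_finType _ _ _
    (fun v : m.-tuple R => sort_perm (fun x => S x + tnth v x)) _ [set` Z]) => s.
  exact: measurable_leader_set.
pose L : {measure set (m.-tuple R) -> \bar R} := pushforward P (noise t).
have := @uniform_cube_translate _ _ _ _ _ (L (measurable_noise t))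
  (noise_rect t) x0 c E c0 mE.
rewrite /= /pushforward subr0 invrK mulrC => h.
have mle (S' : 'I_m -> R) : measurable (leader S' t @^-1` [set` Z]).
  by apply: measurable_preimage_finType; exact: measurable_leader.
rewrite -lee_fin EFinD !fineK ?fin_num_measure //.
rewrite (_ : leader _ t @^-1` _ = noise t @^-1` (translate x0 c @^-1` E)).
  rewrite (_ : leader _ t @^-1` _ = noise t @^-1` E); first exact: h.
  by apply/seteqP; split=> w /=; rewrite leaderE.
apply/seteqP; split=> w /=; rewrite leaderE /E /=;
rewrite (_ : (fun x => S x + tnth (translate x0 c (noise t w)) x) =
  (fun x => S x + (if x == x0 then c else 0) + tnth (noise t w) x)) //;
by apply/funext => x; rewrite tnth_mktuple addrAC addrA.
Qed.

(** The scores are raised one item at a time along a duplicate-free list, each item contributing one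
    bump. *)
Lemma leader_law_shift t (S S' : 'I_m -> R) (Z : {set 'S_m}) :
    (forall x, S x <= S' x) ->
  \sum_(s in Z) leader_law t S' s <=
  \sum_(s in Z) leader_law t S s + eps * \sum_(x < m) (S' x - S x).
Proof.
move=> SS'.
have main (r : seq 'I_m) : uniq r ->
    \sum_(s in Z) leader_law t (fun x => if x \in r then S' x else S x) s <=
    \sum_(s in Z) leader_law t S s + eps * \sum_(x <- r) (S' x - S x).
  elim: r => [_|x0 r IH /= /andP[x0r /IH {}IH]].
    by rewrite big_nil mulr0 addr0.
  rewrite big_cons mulrDr addrCA addrC -lerBlDr; apply: le_trans IH.
  rewrite lerBlDr.
  have c0 : 0 <= S' x0 - S x0 by rewrite subr_ge0.
  apply: le_trans (leader_law_bump t _ x0 Z c0); rewrite le_eqVlt.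
  apply/orP; left; apply/eqP; apply: eq_bigr => s _; congr leader_law.
  apply/funext => x; rewrite inE; case: eqP => [->|_] /=; last by rewrite addr0.
  by rewrite (negPf x0r) addrC subrK.
have := main (index_enum 'I_m) (index_enum_uniq _).
have -> // : (fun x => if x \in index_enum 'I_m then S' x else S x) = S'.
by apply/funext => x; rewrite mem_index_enum.
Qed.

(** For [0 <= g <= b] the gap between the two means is largest when [g] is [b] on the set [Z] where
    the law for [S'] dominates, and 0 elsewhere. *)
Lemma leader_law_stable t (S S' : 'I_m -> R) (g : 'S_m -> R) (b : R) :
    (forall x, S x <= S' x) -> (forall s, 0 <= g s <= b) ->
  \sum_s g s * leader_law t S' s <=
  \sum_s g s * leader_law t S s + b * (eps * \sum_(x < m) (S' x - S x)).
Proof.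
move=> SS' gb; have b0 : 0 <= b.
  by case/andP: (gb 1%g) => g0 /(le_trans g0).
rewrite -lerBlDl -sumrB.
pose Z := [set s | leader_law t S s <= leader_law t S' s]%SET.
apply: (@le_trans _ _ (\sum_(s in Z) b * (leader_law t S' s - leader_law t S s))).
  rewrite [X in _ <= X]big_mkcond; apply: ler_sum => s _.
  have /andP[g0 g1] := gb s; rewrite -mulrBr inE; case: ifP => h.
    by rewrite ler_wpM2r // subr_ge0.
  by rewrite mulr_ge0_le0 // subr_le0 ltW // ltNge h.
rewrite -mulr_sumr ler_wpM2l // sumrB lerBlDl.
exact: leader_law_shift.
Qed.

(** The right side involves only marginal laws, so one perturbation, that of round [t], can be
    shared by all [n] steps. The pathwise bound holds when it lies in the cube, hence almost
    surely. *)
Lemma leader_law_be_the_leader t (S r : nat -> 'I_m -> R) (n : nat) s0 :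
    (forall x, S 0 x = 0) -> (forall i x, S i.+1 x = S i x + r i x) ->
  linear_dcg s0 (S n) - m%:R / eps <=
  \sum_(i < n) \sum_s linear_dcg s (r i) * leader_law t (S i.+1) s.
Proof.
move=> S0 SS.
pose cube := fun _ : 'I_m => `[0, eps^-1]%classic : set R.
have mcube x : measurable (cube x) by exact: measurable_itv.
pose A := noise t @^-1` [set v | forall x, cube x (tnth v x)].
have PA : P A = 1%E.
  rewrite noise_rect //; apply: big1 => x _; exact: integral_uniform_pdf1.
have mA : measurable A.
  have -> : A = \bigcap_(x in [set: 'I_m]) p t x @^-1` cube x.
    apply/seteqP; split=> w /= h x; first by move: (h x); rewrite tnth_mktuple.
    by rewrite tnth_mktuple; exact: h.
  apply: fin_bigcap_measurable => // x _.
  by rewrite -[X in measurable X]setTI; apply: (measurable_p H).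
apply: (@ae_expectation_sum_finType_ge _ _ _ P _ _
    (fun i : 'I_n => leader (S i.+1) t) _ (fun i s => linear_dcg s (r i)) _
    (~` A)).
- by move=> i; exact: measurable_leader.
- exact: measurableC.
  by rewrite probability_setC // PA subee.
move=> w /contrapT Aw.
apply: be_the_leader => // x.
by move: (Aw x); rewrite tnth_mktuple /cube /= in_itv.
Qed.

(** Replacing the leader for [S i.+1] by the one for [S i] costs at most [eps * (m * b)], the shift
    of the law, times the largest gain [m * b]. *)
Lemma ftpl_regret t (S r : nat -> 'I_m -> R) (n : nat) s0 (b : R) :
    (forall x, S 0 x = 0) -> (forall i x, S i.+1 x = S i x + r i x) ->
    (forall i x, 0 <= r i x <= b) ->
  linear_dcg s0 (S n) - m%:R / eps - n%:R * (eps * (m%:R * b) ^+ 2) <=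
  \sum_(i < n) \sum_s linear_dcg s (r i) * leader_law t (S i) s.
Proof.
move=> S0 SS rb.
rewrite lerBlDr; apply: le_trans (leader_law_be_the_leader t n s0 S0 SS) _.
rewrite mulr_natl -[X in _ *+ X]card_ord -sumr_const -big_split.
apply: ler_sum => i _ /=.
have gb s : 0 <= linear_dcg s (r i) <= m%:R * b.
  rewrite linear_dcg_le ?andbT //.
  by apply: linear_dcg_ge0 => x; case/andP: (rb i x).
have SS' x : S i x <= S i.+1 x by rewrite SS lerDl; case/andP: (rb i x).
apply: le_trans (leader_law_stable t SS' gb) _.
rewrite lerD2l expr2 mulrCA; apply: ler_wpM2l; first exact: ltW.
apply: ler_wpM2l; first by case/andP: (gb 1%g) => h /(le_trans h).
rewrite mulr_natl -[X in _ *+ X]card_ord -sumr_const.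
by apply: ler_sum => x _; rewrite SS addrAC subrr add0r; case/andP: (rb i x).
Qed.

End learner.

(** * Draws without replacement *)

Section product_weights.
Context {R : comPzRingType} {I F : finType} (u : I -> F -> R).
Hypothesis sum_u : forall i, \sum_f u i f = 1.

Definition product_weight (v : {ffun I -> F}) : R := \prod_i u i (v i).

Let update (v : {ffun I -> F}) i f : {ffun I -> F} :=
  [ffun j => if j == i then f else v j].

Lemma sum_product_weight : \sum_v product_weight v = 1.
Proof.
rewrite /product_weight -(bigA_distr_bigA (fun i f => u i f)) /=.
by apply: big1 => i _.
Qed.

(* Exchanging coordinate [i] of [v] with an independent copy [f] preserves the
   joint weight of the pair [(v, f)]. *)
Lemma product_weight_indep i (A : {ffun I -> F} -> R) (b : F -> R) :
    (forall v w : {ffun I -> F}, (forall j, j != i -> v j = w j) -> A v = A w) ->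
  \sum_v product_weight v * (A v * b (v i)) =
  (\sum_v product_weight v * A v) * \sum_f u i f * b f.
Proof.
move=> A_indep.
pose swap (vf : {ffun I -> F} * F) := (update vf.1 i vf.2, vf.1 i).
have swapK : involutive swap.
  move=> [v f]; rewrite /swap /=; congr pair; last by rewrite ffunE eqxx.
  by apply/ffunP => j; rewrite !ffunE; case: eqP => // ->.
transitivity (\sum_(vf : {ffun I -> F} * F)
    product_weight vf.1 * u i vf.2 * (A vf.1 * b (vf.1 i))).
  rewrite -(pair_bigA _ (fun v f => product_weight v * u i f * (A v * b (v i)))).
  apply: eq_bigr => v _ /=.
  by under eq_bigr do rewrite mulrAC; rewrite -mulr_sumr sum_u mulr1.
rewrite (reindex_inj (inv_inj swapK)) mulr_suml.
under [RHS]eq_bigr do rewrite mulr_sumr.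
rewrite pair_bigA /=; apply: eq_bigr => -[v f] _ /=.
rewrite (A_indep (update v i f) v); last by move=> j /negPf ji; rewrite ffunE ji.
rewrite ffunE eqxx.
have -> : product_weight (update v i f) * u i (v i) = product_weight v * u i f.
  rewrite /product_weight (bigD1 i) //= [in RHS](bigD1 i) //= ffunE eqxx.
  rewrite (eq_bigr (fun j => u j (v j))); last first.
    by move=> j /negPf ji; rewrite ffunE ji.
  by rewrite mulrAC [in RHS]mulrAC; congr (_ * _); rewrite mulrC.
by rewrite !mulrA; congr (_ * _); rewrite mulrAC.
Qed.

End product_weights.

(** * Uniform draws inside a block *)

Section draws.
Context {T K q : nat}.
Hypotheses (T_gt0 : (0 < T)%N) (K_dvd_T : (K %| T)%N) (q_le : (q <= T %/ K)%N).

Let K_gt0 : (0 < K)%N. Proof. exact: dvdn_gt0 K_dvd_T. Qed.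
Let n_gt0 : (0 < T %/ K)%N. Proof. by rewrite divn_gt0 // dvdn_leq. Qed.

Lemma block_index_ltn (t : 'I_T) : (t %/ (T %/ K) < K)%N.
Proof. by rewrite ltn_divLR // mulnC divnK. Qed.

Definition block_index (t : 'I_T) : 'I_K := Ordinal (block_index_ltn t).

Lemma mem_block (t : 'I_T) (i : 'I_K) : (t \in block T i) = (block_index t == i).
Proof. by rewrite inE -val_eqE. Qed.

Lemma card_block (i : 'I_K) : #|block T i| = (T %/ K)%N.
Proof.
have lt_T (j : 'I_(T %/ K)) : (i * (T %/ K) + j < T)%N.
  rewrite -[X in (_ < X)%N](divnK K_dvd_T) (mulnC _ K).
  apply: (@leq_trans (i.+1 * (T %/ K))); last by rewrite leq_mul2r ltn_ord orbT.
  by rewrite mulSn addnC ltn_add2r.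
pose f j := Ordinal (lt_T j).
have -> : block T i = [set f j | j in 'I_(T %/ K)]%SET.
  apply/setP => t; rewrite inE; apply/eqP/imsetP => [ti|[j _ ->]].
    exists (Ordinal (ltn_pmod t n_gt0)) => //.
    by apply/val_inj; rewrite /= -ti -divn_eq.
  by rewrite /= divnMDl // divn_small ?addn0.
rewrite card_imset ?card_ord // => j1 j2 /(congr1 val) /= /addnI.
exact: val_inj.
Qed.

Lemma draws_gt0 (i : 'I_K) : (0 < #|draws T q i|)%N.
Proof.
have -> : draws T q i =
    [set f : {ffun 'I_q -> 'I_T} in ffun_on (mem (block T i)) | injectiveb f]%SET.
  by apply/setP => f; rewrite !inE andbC; congr (_ && _); apply/forallP/ffun_onP.
by rewrite card_inj_ffuns_on card_ord card_block ffact_gt0.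
Qed.

Context {R : realFieldType}.

Definition draw_weight (i : 'I_K) (f : {ffun 'I_q -> 'I_T}) : R :=
  (f \in draws T q i)%:R / #|draws T q i|%:R.

Lemma draw_weight_ge0 i f : 0 <= draw_weight i f.
Proof. by rewrite divr_ge0. Qed.

Lemma sum_draw_weight i : \sum_f draw_weight i f = 1.
Proof.
rewrite -mulr_suml -natr_sum.
have -> : (\sum_f (f \in draws T q i) = #|draws T q i|)%N.
  by rewrite -sum1_card [RHS]big_mkcond; apply: eq_bigr => f _; case: ifP.
by rewrite divff // pnatr_eq0 -lt0n draws_gt0.
Qed.

(* Transpositions of time points act on the draws, so all the time points of
   the block are equally likely. *)
Lemma draw_marginal i (j : 'I_q) (g : 'I_T -> R) :
  \sum_f draw_weight i f * g (f j) = (\sum_(t in block T i) g t) / (T %/ K)%:R.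
Proof.
(* [N t] is the probability that the [j]th drawn point is [t]. It is constant on the block, vanishes
   outside it and sums to 1. *)
pose N t := \sum_(f : {ffun 'I_q -> 'I_T} | f j == t) draw_weight i f.
have N_const t t' : t \in block T i -> t' \in block T i -> N t = N t'.
  move=> ti t'i.
  pose h (f : {ffun 'I_q -> 'I_T}) : {ffun 'I_q -> 'I_T} :=
    [ffun j => tperm t t' (f j)].
  have hK : involutive h by move=> f; apply/ffunP => k; rewrite !ffunE tpermK.
  rewrite /N (reindex_inj (inv_inj hK)).
  apply: eq_big => [f|f _].
    by rewrite ffunE (canF_eq (tpermK t t')) tpermL.
  rewrite /draw_weight; congr (_%:R / _); rewrite !inE; congr (nat_of_bool (_ && _)).
    apply/injectiveP/injectiveP => f_inj k l.
      by move=> fkl; apply: f_inj; rewrite !ffunE fkl.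
    by rewrite !ffunE => /perm_inj /f_inj.
  have tp s : (tperm t t' s \in block T i) = (s \in block T i).
    by case: tpermP => [->|->|//]; rewrite ti t'i.
  by apply: eq_forallb => k; rewrite ffunE tp.
have N_out t : t \notin block T i -> N t = 0.
  move=> ti; apply: big1 => f /eqP fj; rewrite /draw_weight inE.
  case: forallP => [/(_ j)|]; first by rewrite fj (negPf ti).
  by rewrite andbF mul0r.
have sumN (g' : 'I_T -> R) : \sum_f draw_weight i f * g' (f j) =
    \sum_(t in block T i) N t * g' t.
  rewrite (partition_big (fun f : {ffun 'I_q -> 'I_T} => f j) xpredT) //=.
  rewrite [RHS]big_mkcond; apply: eq_bigr => t _; case: ifPn => [_|/N_out Nt].
    by rewrite /N mulr_suml; apply: eq_bigr => f /eqP <-.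
  transitivity (N t * g' t); last by rewrite Nt mul0r.
  by rewrite /N mulr_suml; apply: eq_bigr => f /eqP <-.
have n_neq0 : (T %/ K)%:R != 0 :> R by rewrite pnatr_eq0 -lt0n.
have N_val t : t \in block T i -> N t = (T %/ K)%:R^-1.
  move=> ti; apply/(mulIf n_neq0); rewrite mulVf //.
  rewrite -[RHS](sum_draw_weight i) -[RHS](eq_bigr _ (fun f _ => mulr1 _)).
  rewrite (sumN (fun=> 1)) (eq_bigr (fun=> N t)).
    by rewrite sumr_const card_block mulr_natr.
  by move=> t' t'i; rewrite mulr1; exact: N_const.
rewrite sumN mulr_suml; apply: eq_bigr => t ti.
by rewrite N_val // mulrC.
Qed.

End draws.

(** * Estimated relevances *)

Lemma gain_ge0 {R : realType} (r : nat) : 0 <= gain r :> R.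
Proof. by rewrite subr_ge0 exprn_ege1 // ler1n. Qed.

Lemma le_gain {R : realType} (r n : nat) : (r <= n)%N -> gain r <= gain n :> R.
Proof. by move=> rn; rewrite lerD2r ler_weXn2l // ler1n. Qed.

Section estimates.
Context {R : realType} {m k T K n : nat}.
Context (cell : 'I_K -> 'I_m -> 'I_(ncells m k)).
Context (expl : 'I_T -> 'I_(ncells m k) -> 'S_m) (rel : 'I_T -> 'I_m -> nat).
Hypothesis rel_le : forall t x, (rel t x <= n)%N.
Implicit Types tau : 'I_K -> {ffun 'I_(ncells m k) -> 'I_T}.

Local Notation estimate tau := (@estimate R _ _ _ _ cell expl rel tau).
Local Notation score tau := (@score R _ _ _ _ cell expl rel tau).

(** Valid for arbitrary [tau]: a lookup past the end of the feedback returns the default relevance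
    0, which is still in range. *)
Lemma estimate_itv tau i x : 0 <= estimate tau i x <= gain n.
Proof.
rewrite gain_ge0 le_gain //=; set s := expl _ _; set r := rel _.
have [j_lt|] := ltnP (item_rank s x).-1 (size (feedback k s r)); last first.
  by move=> /(nth_default 0%N) ->.
by have /mem_take /mapP[j _ ->] := mem_nth 0%N j_lt; exact: rel_le.
Qed.

Lemma estimate_block tau i x : explores cell expl -> tau i (cell i x) \in block T i ->
  estimate tau i x = gain (rel (tau i (cell i x)) x).
Proof.
move=> explP tau_block; have := explP i _ x tau_block.
rewrite /Defs.estimate /item_rank /=; set s := expl _ _ => rank_le.
congr gain; rewrite /feedback nth_take //.
by rewrite (nth_map x) ?size_enum_ord // nth_ord_enum permKV.
Qed.

Lemma scoreS tau (i : 'I_K) x :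
  score tau i.+1 x = score tau i x + estimate tau i x.
Proof.
rewrite /Defs.score (bigD1 i) //= addrC; congr (_ + _).
by apply: eq_bigl => l; rewrite ltnS andbC ltn_neqAle -val_eqE.
Qed.

(** Scores freeze after the last block, so rewards can be indexed by all natural numbers as
    [ftpl_regret] expects. *)
Lemma scoreS_out tau (i : nat) x : (K <= i)%N -> score tau i.+1 x = score tau i x.
Proof.
move=> Ki; apply: eq_bigl => l; have := ltn_ord l.
by move=> /leq_trans /(_ Ki) h; rewrite h ltnS ltnW.
Qed.

(** Scores look only at earlier draws, whence their independence from the draw of the current
    block. *)
Lemma eq_score tau tau' (i : nat) :
  (forall l : 'I_K, (l < i)%N -> tau l = tau' l) -> score tau i = score tau' i.
Proof.
move=> tt; apply/funext => x; apply: eq_bigr => l li.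
by rewrite /Defs.estimate tt.
Qed.

Hypotheses (T_gt0 : (0 < T)%N) (K_dvd_T : (K %| T)%N).
Hypothesis cells_fit : (ncells m k <= T %/ K)%N.
Hypothesis explP : explores cell expl.

Local Notation weight := (product_weight (@draw_weight T K (ncells m k) R)).

Let sum_dw := @sum_draw_weight T K (ncells m k) T_gt0 K_dvd_T cells_fit R.

(** The factor [A] ignores the draw of block [i], so the product law splits. What remains is the
    mean of the gain at one uniformly drawn point of the block. *)
Lemma estimate_unbiased (i : 'I_K) x
    (A : {ffun 'I_K -> {ffun 'I_(ncells m k) -> 'I_T}} -> R) :
    (forall v w : {ffun 'I_K -> {ffun 'I_(ncells m k) -> 'I_T}},
       (forall l, l != i -> v l = w l) -> A v = A w) ->
  \sum_tau weight tau * (A tau * estimate tau i x) =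
  (\sum_tau weight tau * A tau) *
    ((\sum_(t in block T i) gain (rel t x)) / (T %/ K)%:R).
Proof.
move=> A_indep.
rewrite (product_weight_indep sum_dw (fun f => estimate (fun=> f) i x) A_indep).
congr (_ * _).
rewrite -(draw_marginal T_gt0 K_dvd_T cells_fit i (cell i x) (fun t => gain (rel t x))).
apply: eq_bigr => f _; rewrite /draw_weight.
(* The estimate is the true gain only for time points inside the block; any other [f] has weight
   0. *)
case: (boolP (f \in draws T (ncells m k) i)) => [|_]; last by rewrite !mul0r.
rewrite inE => /andP[_ /forallP f_block].
by rewrite estimate_block.
Qed.

Lemma sum_block (F : 'I_T -> R) :
  \sum_t F t = \sum_(i < K) \sum_(t in block T i) F t.
Proof.
rewrite (partition_big (block_index T_gt0 K_dvd_T) xpredT) //.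
by apply: eq_bigr => i _; apply: eq_bigl => t; rewrite mem_block.
Qed.

(** Unbiasedness with constant factor 1, summed over blocks: the comparator's total on the estimates
    averages to its true total divided by the block length. *)
Lemma mean_score_dcg s :
  \sum_tau weight tau * linear_dcg s (score tau K) =
  (\sum_t dcg s (rel t)) / (T %/ K)%:R.
Proof.
transitivity (\sum_(i < K) \sum_(x < m) discount ((s^-1)%g x) *
    \sum_tau weight tau * (1 * estimate tau i x)).
  under [RHS]eq_bigr do under eq_bigr do rewrite mulr_sumr.
  under [RHS]eq_bigr do rewrite exchange_big.
  rewrite [RHS]exchange_big; apply: eq_bigr => tau _ /=.
  have -> : score tau K = fun x => \sum_(i < K) estimate tau i x.
    by apply/funext => x; apply: eq_bigl => l; rewrite ltn_ord.
  rewrite (linear_dcg_sum xpredT) mulr_sumr; apply: eq_bigr => i _.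
  rewrite linear_dcgE mulr_sumr; apply: eq_bigr => x _; ring.
rewrite sum_block mulr_suml; apply: eq_bigr => i _.
under eq_bigr => x _.
  rewrite (@estimate_unbiased i x (fun=> 1)) //.
  under eq_bigr do rewrite mulr1.
  rewrite (sum_product_weight sum_dw) mul1r.
  over.
rewrite exchange_big mulr_suml; apply: eq_bigr => x _ /=.
by rewrite mulrA mulr_sumr; congr (_ / _); apply: eq_bigr => t _; rewrite mulrC.
Qed.

(* [F S s] stands for the probability of output [s] after the scores [S]. *)
Lemma block_dcg (F : ('I_m -> R) -> 'S_m -> R) (i : 'I_K) :
  \sum_tau weight tau *
    \sum_(t in block T i) \sum_s dcg s (rel t) * F (score tau i) s =
  (T %/ K)%:R * \sum_tau weight tau *
    \sum_s linear_dcg s (estimate tau i) * F (score tau i) s.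
Proof.
(* [A x] is the mean discount given to item [x] in block [i]; the draws enter it only through the
   earlier blocks. *)
pose A x tau := \sum_(s : 'S_m) discount ((s^-1)%g x) * F (score tau i) s.
have A_indep x (v w : {ffun 'I_K -> {ffun 'I_(ncells m k) -> 'I_T}}) :
    (forall l, l != i -> v l = w l) -> A x v = A x w.
  move=> vw; apply: eq_bigr => s _; rewrite (@eq_score v w) // => l li.
  by apply: vw; rewrite -val_eqE ltn_eqF.
have n_neq0 : (T %/ K)%:R != 0 :> R.
  by rewrite pnatr_eq0 -lt0n divn_gt0 ?(dvdn_gt0 T_gt0) // dvdn_leq.
(* In this common form the factors are separated: the left side reaches it by exchanging sums, the
   right side by unbiasedness. *)
transitivity (\sum_(x < m) (\sum_tau weight tau * A x tau) *
    \sum_(t in block T i) gain (rel t x)).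
  under [RHS]eq_bigr do rewrite mulr_suml.
  rewrite [RHS]exchange_big; apply: eq_bigr => tau _ /=.
  under [RHS]eq_bigr do rewrite -mulrA.
  rewrite -mulr_sumr; congr (_ * _).
  under [RHS]eq_bigr do rewrite mulr_sumr.
  rewrite [RHS]exchange_big; apply: eq_bigr => t _ /=.
  under [RHS]eq_bigr do rewrite mulr_suml.
  rewrite [RHS]exchange_big; apply: eq_bigr => s _ /=.
  rewrite -[dcg s (rel t)]/(linear_dcg s (fun x => gain (rel t x))).
  by rewrite linear_dcgE mulr_suml; apply: eq_bigr => x _; ring.
transitivity (\sum_(x < m) (T %/ K)%:R *
    \sum_tau weight tau * (A x tau * estimate tau i x)).
  by apply: eq_bigr => x _; rewrite (estimate_unbiased x
    (A := fun v : {ffun 'I_K -> {ffun 'I_(ncells m k) -> 'I_T}} => A x v)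
    (A_indep x)); field.
rewrite -mulr_sumr; congr (_ * _); rewrite exchange_big.
apply: eq_bigr => tau _ /=; rewrite -mulr_sumr; congr (_ * _).
under [LHS]eq_bigr do rewrite mulr_suml.
rewrite [LHS]exchange_big; apply: eq_bigr => s _ /=.
by rewrite linear_dcgE mulr_suml; apply: eq_bigr => x _; ring.
Qed.

End estimates.

(** * Regret of the block algorithm *)

Section regret.
Context {d : measure_display} {Om : measurableType d} {R : realType}.
Context {P : probability Om R} {m k T K n : nat} {eps : R}.
Context (cell : 'I_K -> 'I_m -> 'I_(ncells m k)).
Context (expl : 'I_T -> 'I_(ncells m k) -> 'S_m) (rel : 'I_T -> 'I_m -> nat).
Context (tau : 'I_K -> Om -> {ffun 'I_(ncells m k) -> 'I_T}).
Context (p : 'I_T -> 'I_m -> Om -> R).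
Hypothesis rel_le : forall t x, (rel t x <= n)%N.
Hypotheses (T_gt0 : (0 < T)%N) (K_dvd_T : (K %| T)%N).
Hypothesis cells_fit : (ncells m k <= T %/ K)%N.
Hypothesis explP : explores cell expl.
Hypothesis H : learner_randomness P eps tau p.
Hypothesis eps_gt0 : 0 < eps.

Local Notation plan := {ffun 'I_K -> {ffun 'I_(ncells m k) -> 'I_T}}.
Local Notation weight := (product_weight (@draw_weight T K (ncells m k) R)).
Local Notation score f i := (@score R _ _ _ _ cell expl rel f i).
Local Notation estimate f i := (@estimate R _ _ _ _ cell expl rel f i).
(** Round 0 serves as the reference round for all leader laws. *)
Local Notation law S s := (leader_law P p (Ordinal T_gt0) S s).
Local Notation b := (gain n : R).

Let sum_dw := @sum_draw_weight T K (ncells m k) T_gt0 K_dvd_T cells_fit R.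

Let learner_output (t : 'I_T) (w : Om) : 'S_m :=
  output cell expl rel (fun i => tau i w) (fun t x => p t x w) t.

(** Recording all the draws next to the output gives a finite-valued variable on whose fibres the
    scores, and the choice between exploring and exploiting, are fixed. *)
Let joint_output (t : 'I_T) (w : Om) : plan * 'S_m :=
  ([ffun i => tau i w], learner_output t w).

Let explored (f : plan) (t : 'I_T) :=
  [pick ij : 'I_K * 'I_(ncells m k) | f ij.1 ij.2 == t].

Let joint_outputE t (f : plan) s : joint_output t @^-1` [set (f, s)] =
  draw_event tau f `&`
  (if explored f t is Some ij then [set _ | expl t ij.2 = s]
   else leader p (score f (t %/ (T %/ K))%N) t @^-1` [set s]).
Proof.
have fE w : (forall i, tau i w = f i) -> (fun i => tau i w) = f.
  by move=> h; apply/funext.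
apply/seteqP; split=> w /=.
  move=> [ft]; have fw i : tau i w = f i by rewrite -ft ffunE.
  rewrite /learner_output (fE w fw) /output -/(explored f t) => <-.
  by split=> //; case: (explored f t).
move=> [fw]; rewrite /joint_output.
have -> : [ffun i => tau i w] = f by apply/ffunP => i; rewrite ffunE.
rewrite /learner_output (fE w fw) /output -/(explored f t) => h.
congr pair; move: h; case: (explored f t) => [ij|] h; exact: h.
Qed.

Let measurable_joint_output t fs : measurable (joint_output t @^-1` [set fs]).
Proof.
case: fs => f s; rewrite joint_outputE; apply: measurableI.
  exact: (measurable_draw_event H).
case: explored => [ij|]; last exact: (measurable_leader H).
by have [->|es] := pselect (expl t ij.2 = s);
  [rewrite (_ : [set _ | _] = setT)|rewrite (_ : [set _ | _] = set0)] => //;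
  apply/seteqP; split.
Qed.

Let prob_draw (f : plan) : P (draw_event tau f) = (weight f)%:E.
Proof.
rewrite (prob_draw_event H eps_gt0 (Ordinal T_gt0)) /product_weight -prodEFin.
by apply: eq_bigr => i _; rewrite (uniform_tau H).
Qed.

Let weight_ge0 (f : plan) : 0 <= weight f.
Proof. by apply: prodr_ge0 => i _; exact: draw_weight_ge0. Qed.

Let dcg_itv (s : 'S_m) t : 0 <= (dcg s (rel t) : R) <= m%:R * b.
Proof.
have gb x : 0 <= (gain (rel t x) : R) <= b by rewrite gain_ge0 le_gain.
rewrite -[dcg s _]/(linear_dcg s (fun x => gain (rel t x))).
by rewrite linear_dcg_le // andbT linear_dcg_ge0 // => x; case/andP: (gb x).
Qed.

Let mean_dcg (S : 'I_m -> R) t : R := \sum_s dcg s (rel t) * law S s.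

Let mean_dcg_le S t : mean_dcg S t <= m%:R * b.
Proof.
rewrite -[leRHS]mulr1 -[X in _ * X](sum_leader_law H (Ordinal T_gt0) S).
rewrite mulr_sumr.
apply: ler_sum => s _; rewrite ler_wpM2r ?leader_law_ge0 //.
by case/andP: (dcg_itv s t).
Qed.

(* An exploration round forfeits at most the largest gain [m * b]. *)
Let round_gain (t : 'I_T) (f : plan) :
  weight f * (mean_dcg (score f (t %/ (T %/ K))%N) t -
              m%:R * b * (explored f t : bool)%:R) <=
  \sum_s dcg s (rel t) * fine (P (joint_output t @^-1` [set (f, s)])).
Proof.
case E: (explored f t) => [ij|] /=.
  apply: (@le_trans _ _ 0).
    by rewrite mulr_ge0_le0 ?weight_ge0 // mulr1 subr_le0 mean_dcg_le.
  apply: sumr_ge0 => s _; rewrite mulr_ge0 ?fine_ge0 //.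
  by case/andP: (dcg_itv s t).
rewrite mulr0 subr0 mulr_sumr le_eqVlt; apply/orP; left; apply/eqP.
apply: eq_bigr => s _; rewrite joint_outputE E.
rewrite (leader_draw_joint H eps_gt0 t (Ordinal T_gt0)) prob_draw -EFinM /=.
ring.
Qed.

(** Explored rounds are values of [f], of which there are at most [K * ncells m k], coincidences
    only lowering the count. *)
Let explored_count (f : plan) :
  \sum_t (explored f t : bool)%:R <= (K * ncells m k)%:R :> R.
Proof.
rewrite -natr_sum ler_nat.
pose A := [set (f ij.1) ij.2 | ij : 'I_K * 'I_(ncells m k)]%SET.
apply: (@leq_trans #|A|).
  rewrite -sum1_card [leqRHS]big_mkcond; apply: leq_sum => t _.
  rewrite /explored; case: pickP => // ij /eqP <- /=.
  by have -> : f ij.1 ij.2 \in A by apply/imsetP; exists ij.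
by rewrite (leq_trans (leq_imset_card _ _)) // card_prod !card_ord.
Qed.

Let expected_gain : R :=
  \sum_t \sum_fs dcg fs.2 (rel t) * fine (P (joint_output t @^-1` [set fs])).

Let expected_gainE :
  ('E_P[fun w => (\sum_(t < T) dcg (learner_output t w) (rel t))%R] =
   expected_gain%:E)%E.
Proof.
exact: (expectation_sum_finType P measurable_joint_output
  (fun t fs => dcg fs.2 (rel t))).
Qed.

Let expected_gain_ge s :
  \sum_(t < T) dcg s (rel t) <=
  expected_gain + (K * ncells m k)%:R * (m%:R * b) +
  (T %/ K)%:R * (m%:R / eps + K%:R * (eps * (m%:R * b) ^+ 2)).
Proof.
have n_gt0 : 0 < (T %/ K)%:R :> R.
  by rewrite ltr0n divn_gt0 ?(dvdn_gt0 T_gt0) // dvdn_leq.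
(* The mean gain of FTPL on the [K] estimates, for fixed draws [f]. *)
pose follow (f : plan) := \sum_(i < K) \sum_s linear_dcg s (estimate f i) * law (score f i) s.
(* Every round is first credited with the mean gain of exploitation, the exploration rounds being
   charged [m * b]. [block_dcg] then trades true relevances for estimates. *)
have gain_follow : (T %/ K)%:R * \sum_f weight f * follow f -
    (K * ncells m k)%:R * (m%:R * b) <= expected_gain.
  apply: (@le_trans _ _ (\sum_(t < T) \sum_(f : plan) weight f *
     (mean_dcg (score f (t %/ (T %/ K))%N) t -
      m%:R * b * (explored f t : bool)%:R))); last first.
    apply: ler_sum => t _; rewrite (_ : \sum_(fs : plan * 'S_m) _ =
      \sum_(f : plan) \sum_s dcg s (rel t) *
        fine (P (joint_output t @^-1` [set (f, s)]))).
      by apply: ler_sum => f _; exact: round_gain.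
    by rewrite pair_bigA; apply: eq_bigr => -[].
  rewrite exchange_big /=.
  under [leRHS]eq_bigr do rewrite -mulr_sumr sumrB mulrBr.
  rewrite sumrB; apply: lerB.
    rewrite le_eqVlt; apply/orP; left; apply/eqP.
    transitivity (\sum_(i < K) (T %/ K)%:R * \sum_f weight f *
        \sum_s linear_dcg s (estimate f i) * law (score f i) s).
      rewrite -mulr_sumr exchange_big /=; congr (_ * _).
      by apply: eq_bigr => f _; rewrite mulr_sumr.
    under eq_bigr => i _ do
      rewrite -(block_dcg rel T_gt0 K_dvd_T cells_fit explP (fun S s => law S s)).
    rewrite exchange_big; apply: eq_bigr => f _; rewrite -mulr_sumr.
    congr (_ * _); rewrite (sum_block T_gt0 K_dvd_T); apply: eq_bigr => i _.
    by apply: eq_bigr => t; rewrite inE => /eqP ->.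
  rewrite -[leRHS]mul1r -[X in _ <= X * _](sum_product_weight sum_dw) mulr_suml.
  apply: ler_sum => f _; apply: ler_wpM2l => //.
  rewrite -mulr_sumr [leLHS]mulrC; apply: ler_wpM2r.
    by rewrite mulr_ge0 ?gain_ge0.
  exact: explored_count.
have follow_ge (f : plan) : linear_dcg s (score f K) -
    (m%:R / eps + K%:R * (eps * (m%:R * b) ^+ 2)) <= follow f.
  (* Defining the rewards as score increments gives the recursion of [ftpl_regret] at every natural
     index, beyond [K] included. *)
  pose r (i : nat) x : R := score f i.+1 x - score f i x.
  have rE (i : 'I_K) : r i = estimate f i.
    by apply/funext => x; rewrite /r scoreS addrAC subrr add0r.
  have r_itv i x : 0 <= r i x <= b.
    have [iK|Ki] := ltnP i K.
      by rewrite (rE (Ordinal iK)) estimate_itv.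
    by rewrite /r scoreS_out // subrr lexx gain_ge0.
  have -> : follow f =
      \sum_(i < K) \sum_s linear_dcg s (r i) * law (score f i) s.
    by apply: eq_bigr => i _; rewrite rE.
  rewrite opprD addrA.
  apply: (ftpl_regret H eps_gt0 (Ordinal T_gt0) K s) => // [x|i x].
    by apply: big1 => l; rewrite ltn0.
  by rewrite /r addrC subrK.
(* Averaging the FTPL bound over the draws turns the comparator's score back into its true DCG. *)
have mean_follow : (\sum_t dcg s (rel t)) / (T %/ K)%:R -
    (m%:R / eps + K%:R * (eps * (m%:R * b) ^+ 2)) <= \sum_f weight f * follow f.
  rewrite -(mean_score_dcg rel T_gt0 K_dvd_T cells_fit explP) lerBlDr.
  rewrite -[X in _ <= _ + X]mul1r.
  rewrite -[X in _ <= _ + X * _](sum_product_weight sum_dw) mulr_suml.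
  rewrite -big_split; apply: ler_sum => f _ /=.
  by rewrite -mulrDr ler_wpM2l // -lerBlDr; exact: follow_ge.
move: mean_follow; rewrite -(ler_pM2l n_gt0) mulrBr mulrCA divff ?gt_eqF // mulr1.
move: gain_follow; set e := _ * (_ + _); set F := _ * \sum_f _; lra.
Qed.

Lemma block_ftpl_regret :
  (regret P rel learner_output <=
   ((K * ncells m k)%:R * (m%:R * b) +
    (T %/ K)%:R * (m%:R / eps + K%:R * (eps * (m%:R * b) ^+ 2)))%:E)%E.
Proof.
rewrite /regret expected_gainE -EFinB lee_fin lerBlDr.
(* The default value 0 of the maximum must satisfy the bound as well; it does because every term is
   nonnegative. *)
apply: bigmax_le => [|s _]; last by rewrite addrC addrA; exact: expected_gain_ge.
rewrite !addr_ge0 ?mulr_ge0 ?gain_ge0 ?exprn_ge0 ?invr_ge0 ?(ltW eps_gt0) //.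
  by rewrite addr_ge0 ?mulr_ge0 ?gain_ge0 ?exprn_ge0 ?invr_ge0 ?(ltW eps_gt0).
apply: sumr_ge0 => t _; apply: sumr_ge0 => fs _.
by rewrite mulr_ge0 ?fine_ge0 //; case/andP: (dcg_itv fs.2 t).
Qed.

End regret.

(** * Tuning the parameters *)

(** With fractional powers written as integer powers of cube roots, the identities between scales
    become rational and [field] proves them. *)
Lemma powR_third {R : realType} (x : R) (j : nat) : 0 <= x ->
  x `^ (j%:R / 3) = (x `^ (3^-1)) ^+ j.
Proof. by move=> x0; rewrite -powR_mulrn ?powR_ge0 // -powRrM mulrC. Qed.

Lemma cube_root {R : realType} (x : R) : 0 <= x -> (x `^ (3^-1)) ^+ 3 = x.
Proof. by move=> x0; rewrite -powR_third // divff ?powRr1. Qed.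

Section scales.
Context {R : realType} {m k T : nat}.
Hypotheses (m_gt0 : (0 < m)%N) (k_gt0 : (0 < k)%N) (T_gt0 : (0 < T)%N).

Lemma ncells_gt0 : (0 < ncells m k)%N.
Proof. by rewrite divn_gt0 // -[leqLHS]prednK // -addn1 addnC leq_add2r. Qed.

(** The regret scale without its factor [2 ^+ n - 1]. *)
Definition unit_scale : R :=
  m%:R `^ (4 / 3) * (ncells m k)%:R `^ (1 / 3) * T%:R `^ (2 / 3).

Lemma unit_scale_gt0 : 0 < unit_scale.
Proof. by rewrite !mulr_gt0 ?powR_gt0 ?ltr0n ?ncells_gt0. Qed.

Lemma blocks_scale_gt0 : 0 < blocks_scale m k T :> R.
Proof. by rewrite divr_gt0 ?mulr_gt0 ?powR_gt0 ?ltr0n ?ncells_gt0. Qed.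

Let root_gt0 (x : nat) : (0 < x)%N -> 0 < (x%:R : R) `^ (3^-1).
Proof. by move=> x0; rewrite powR_gt0 // ltr0n. Qed.

(** At [K = blocks_scale] the exploration loss, per unit of gain, is exactly the target rate. *)
Lemma blocks_scale_cells :
  blocks_scale m k T * (ncells m k)%:R * m%:R = unit_scale.
Proof.
have q0 := root_gt0 ncells_gt0.
rewrite /blocks_scale /unit_scale -[1 / 3]/(1%:R / 3) !powR_third //.
rewrite -[X in _ * X * _](@cube_root R) // -[X in _ * X = _](@cube_root R) //.
by field; rewrite gt_eqF.
Qed.

(** Squared form of [unit_scale = T m^(3/2) / sqrt K] at [K = blocks_scale]: the FTPL terms have the
    target rate too. *)
Lemma unit_scale_sqr : unit_scale ^+ 2 * blocks_scale m k T = T%:R ^+ 2 * m%:R ^+ 3.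
Proof.
have q0 := root_gt0 ncells_gt0.
rewrite /blocks_scale /unit_scale -[1 / 3]/(1%:R / 3) !powR_third //.
rewrite -[X in _ = X ^+ 2 * _](@cube_root R) // -[X in _ = _ * X ^+ _](@cube_root R) //.
by field; rewrite gt_eqF.
Qed.

End scales.

(** The summand [a] pays for exploration, [gain n / c] for the perturbation and [c / gain n] for the
    instability of the leader. Of the two factors [a] on the last two, one comes from [eps] and one
    from [K]. *)
Lemma regret_bound_constant {R : realType} (n : nat) (a c : R) :
    (0 < n)%N -> 1 <= a -> 0 < c ->
  regret_bound n a c (a + a ^+ 2 * (gain n / c + c / gain n)).
Proof.
move=> n_gt0 a1 c_gt0 m k T K eps m_gt0 k_gt0 T_gt0 KT cells_fit.
move=> /andP[K_ge K_le] /andP[eps_ge eps_le].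
move=> cell expl cellP explP rel rel_le d Om P tau p H.
have K_nat_gt0 : (0 < K)%N by exact: dvdn_gt0 KT.
have a_gt0 : 0 < a by lra.
have G_gt0 : 0 < gain n :> R.
  by rewrite subr_gt0 exprn_egt1 ?ltr1n // -lt0n.
have K_gt0 : 0 < K%:R :> R by rewrite ltr0n.
have T_gt0' : 0 < T%:R :> R by rewrite ltr0n.
have m_gt0' : 0 < m%:R :> R by rewrite ltr0n.
pose S := @unit_scale R m k T.
pose s : R := Num.sqrt (m * K)%:R.
have s_gt0 : 0 < s by rewrite sqrtr_gt0 ltr0n muln_gt0 m_gt0.
have s_sqr : s ^+ 2 = m%:R * K%:R by rewrite sqr_sqrtr // natrM.
have E_gt0 : 0 < eps_scale n m K :> R.
  by rewrite divr_gt0 // mulr_gt0 // exprn_gt0.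
have eps_gt0 : 0 < eps by rewrite (lt_le_trans _ eps_ge) // divr_gt0 // mulr_gt0.
apply: le_trans (block_ftpl_regret rel_le T_gt0 KT cells_fit explP H eps_gt0) _.
rewrite lee_fin -[regret_scale _ _ _ _](_ : gain n * S = _); last first.
  by rewrite /S /unit_scale /regret_scale !mulrA.
set G := gain n in G_gt0 *.
have S_gt0 : 0 < S by exact: unit_scale_gt0.
have B_gt0 := @blocks_scale_gt0 R m k T m_gt0 k_gt0 T_gt0.
have -> : (T %/ K)%:R = T%:R / K%:R :> R.
  by rewrite -[in RHS](divnK KT) natrM mulfK // gt_eqF.
(* Up to factors in [a], [c] and [gain n], both FTPL terms have size [Q = T m^(3/2) / sqrt K]. *)
pose Q := T%:R * m%:R ^+ 2 / s.
have Q_gt0 : 0 < Q by rewrite divr_gt0 ?mulr_gt0 ?exprn_gt0.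
(* The lower bound on [K] gives [Q ^+ 2 <= a * S ^+ 2]; since [1 <= a], the root of [a] is relaxed
   to [a]. *)
have Q_le : Q <= a * S.
  rewrite -(@ler_pXn2r _ 2) ?nnegrE ?(ltW Q_gt0) ?(ltW (mulr_gt0 a_gt0 S_gt0)) //.
  have -> : Q ^+ 2 = S ^+ 2 * (blocks_scale m k T / K%:R).
    rewrite mulrA unit_scale_sqr // /Q expr_div_n s_sqr; field.
    by rewrite !gt_eqF.
  rewrite (exprMn _ a S) [leRHS]mulrC; apply: ler_wpM2l.
    by rewrite exprn_ge0 // ltW.
  rewrite ler_pdivrMr // expr2 -mulrA; move: K_ge; rewrite ler_pdivrMr // => B_le.
  by apply: le_trans B_le _; rewrite mulrC ler_peMl // ltW // mulr_gt0.
have explore_le : (K * ncells m k)%:R * (m%:R * G) <= a * S * G.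
  rewrite natrM mulrA ler_wpM2r ?(ltW G_gt0) // /S -blocks_scale_cells //.
  by rewrite 2!(mulrA a); do 2![apply: ler_wpM2r => //].
(* The perturbation term uses the lower bound on [eps], the drift term below the upper bound. *)
have bias_le : T%:R / K%:R * (m%:R / eps) <= a * G ^+ 2 / c * Q.
  have -> : a * G ^+ 2 / c * Q =
      T%:R / K%:R * (m%:R / (c * eps_scale n m K / a)).
    have -> : Q = T%:R * m%:R * s / K%:R.
      have s_neq0 : s != 0 by rewrite gt_eqF.
      rewrite /Q; apply: (mulIf s_neq0).
      rewrite divfK ?gt_eqF // mulrAC -[_ * s * s]mulrA -expr2 s_sqr; field.
      by rewrite gt_eqF.
    rewrite /eps_scale -/s -[2 ^+ n - 1]/G; field.
    by rewrite !gt_eqF.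
  rewrite ler_pM2l ?divr_gt0 // ler_pM2l //.
  by rewrite lef_pV2 ?posrE // divr_gt0 // mulr_gt0.
have drift_le : T%:R / K%:R * (K%:R * (eps * (m%:R * G) ^+ 2)) <= a * c * Q.
  have -> : T%:R / K%:R * (K%:R * (eps * (m%:R * G) ^+ 2)) =
      T%:R * (m%:R * G) ^+ 2 * eps by field; rewrite gt_eqF.
  have -> : a * c * Q = T%:R * (m%:R * G) ^+ 2 * (a * (c * eps_scale n m K)).
    by rewrite /eps_scale -/s -[2 ^+ n - 1]/G /Q; field; rewrite !gt_eqF.
  by rewrite ler_pM2l // mulr_gt0 ?exprn_gt0 ?mulr_gt0.
have -> : (a + a ^+ 2 * (G / c + c / G)) * (G * S) =
    a * S * G + (a * G ^+ 2 / c * (a * S) + a * c * (a * S)).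
  by field; rewrite !gt_eqF.
apply: lerD; first exact: explore_le.
rewrite mulrDr; apply: lerD.
  by apply: le_trans bias_le _; rewrite ler_pM2l // divr_gt0 ?mulr_gt0 ?exprn_gt0.
by apply: le_trans drift_le _; rewrite ler_pM2l // mulr_gt0.
Qed.

(** The two conjuncts are the two ways to read the constants: [C] independent of [n] with [c] chosen
    from [n], or [c = 1] with [C] depending on [n]. *)
Theorem corollary10 (R : realType) (a : R) (ha : 1 <= a) :
  (exists2 C : R, 0 < C &
     forall n : nat, (0 < n)%N ->
       exists2 c : R, 0 < c & regret_bound n a c C) /\
  (forall n : nat, (0 < n)%N ->
     exists2 C : R, 0 < C & regret_bound n a 1 C).
Proof.
have gain_gt0 n : (0 < n)%N -> 0 < gain n :> R.
  by move=> n0; rewrite subr_gt0 exprn_egt1 ?ltr1n // -lt0n.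
have a_gt0 : 0 < a by lra.
split=> [|n n_gt0].
  (* [c = gain n] minimizes [gain n / c + c / gain n], with value 2, which leaves a constant
     depending on [a] alone. *)
  exists (a + a ^+ 2 * 2); first by rewrite addr_gt0 ?mulr_gt0 ?exprn_gt0.
  move=> n n_gt0; have G0 := gain_gt0 n n_gt0; exists (gain n) => //.
  have := regret_bound_constant n_gt0 ha G0.
  by rewrite divff ?gt_eqF // -[1 + 1]/2.
have G0 := gain_gt0 n n_gt0.
exists (a + a ^+ 2 * (gain n / 1 + 1 / gain n)); last exact: regret_bound_constant.
by rewrite addr_gt0 // mulr_gt0 ?exprn_gt0 // addr_gt0 ?divr_gt0.
Qed.
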